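(* Let $K$ be a field of characteristic zero, let $n\ge 1$, let $R=K[x_1,\ldots,x_n]$ be the polynomial ring with $\deg x_i=1$, and let $d_1,\ldots,d_n$ be positive integers. For $n\ge 2$, let $$l_i=a_{i1}x_1+a_{i2}x_2+\cdots+a_{i,i+1}x_{i+1}\quad (i=1,\ldots,n-1),\qquad l_n=a_{n1}x_1+\cdots+a_{nn}x_n,$$ with $a_{ij}\in K$, and let $I=(x_1^{d_1}l_1,\,x_2^{d_2}l_2,\ldots,x_n^{d_n}l_n)\subset R$; assume that $I$ is an Artinian complete intersection ideal (i.e. $R/I$ is finite-dimensional over $K$). For $n=1$, put $I=(x_1^{d_1+1})\subset K[x_1]$. Then $A=R/I$ has the strong Lefschetz property.
   Context: A standard graded Artinian $K$-algebra is $A=\bigoplus_{i=0}^c A_i$ with $A_0=K$, generated by $A_1$, finite-dimensional, and $A_c\neq 0$. $A$ has the strong Lefschetz property (SLP) if there exists a linear form $z\in A_1$ such that the multiplication map $\times z^d: A_i\to A_{i+d}$ has full rank (i.e. is injective or surjective) for all $1\le d\le c-1$ and $0\le i\le c-d$; such $z$ is called a strong Lefschetz (SL) element. *)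

(* Defs.v *)
From HB Require Import structures.
From mathcomp Require Import all_boot all_order all_algebra.
Set Implicit Arguments. Unset Strict Implicit. Unset Printing Implicit Defensive.
Import Order.TTheory GRing.Theory Num.Theory.
Local Open Scope ring_scope.

Section MPoly.
Variables (K : fieldType) (n : nat).

Definition mono := {ffun 'I_n -> nat}.
Definition mdeg (e : mono) : nat := (\sum_(i < n) e i)%N.
Definition madde (e f : mono) : mono := [ffun i => (e i + f i)%N].

(* a polynomial is a finite formal sum of terms c * x^e *)
Definition mpoly := seq (K * mono).
Definition mcoef (p : mpoly) (e : mono) : K := \sum_(t <- p | t.2 == e) t.1.
Definition meq (p q : mpoly) : Prop := forall e, mcoef p e = mcoef q e.

Definition mzero : mpoly := [::].
Definition madd (p q : mpoly) : mpoly := p ++ q.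
Definition mscale (c : K) (p : mpoly) : mpoly := [seq (c * t.1, t.2) | t <- p].
Definition msub (p q : mpoly) : mpoly := madd p (mscale (-1) q).
Definition mmul (p q : mpoly) : mpoly :=
  [seq (t.1 * u.1, madde t.2 u.2) | t <- p, u <- q].
Definition mone : mpoly := [:: (1, [ffun _ => 0%N])].
Definition mX (i : 'I_n) : mpoly := [:: (1, [ffun j => nat_of_bool (j == i)])].
Definition mpow (p : mpoly) (k : nat) : mpoly := iter k (mmul p) mone.

(* p is homogeneous of degree k (the zero polynomial is homogeneous of every degree) *)
Definition homog (k : nat) (p : mpoly) : Prop :=
  forall e, mcoef p e != 0 -> mdeg e = k.

Definition in_ideal (m : nat) (g : 'I_m -> mpoly) (p : mpoly) : Prop :=
  exists h : 'I_m -> mpoly, meq p (\big[madd/mzero]_(j < m) mmul (h j) (g j)).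

Definition finite_dim (m : nat) (g : 'I_m -> mpoly) : Prop :=
  exists s : seq mpoly, forall p, exists c : nat -> K,
    in_ideal g (msub p (\big[madd/mzero]_(j < size s) mscale (c j) (nth mzero s j))).

Definition Apiece_zero (m : nat) (g : 'I_m -> mpoly) (k : nat) : Prop :=
  forall p, homog k p -> in_ideal g p.

Definition mult_full_rank (m : nat) (g : 'I_m -> mpoly) (z : mpoly) (d i : nat) : Prop :=
  (forall p, homog i p -> in_ideal g (mmul (mpow z d) p) -> in_ideal g p)
  \/ (forall q, homog (i + d) q ->
        exists p, homog i p /\ in_ideal g (msub q (mmul (mpow z d) p))).

Definition SLP (m : nat) (g : 'I_m -> mpoly) : Prop :=
  exists c : nat,
    (exists p, homog c p /\ ~ in_ideal g p) /\
    (forall k, (c < k)%N -> Apiece_zero g k) /\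
    exists z, homog 1 z /\
      forall d i, (1 <= d <= c - 1)%N -> (i <= c - d)%N -> mult_full_rank g z d i.

(* generators of I (0-indexed): for n >= 2, x_i^(d_i) l_i with
   l_i = sum_{j <= i+1} a_ij x_j (so l_(n-1) involves all variables);
   for n = 1, x_1^(d_1 + 1). *)
Definition lform (a : 'I_n -> 'I_n -> K) (i : 'I_n) : mpoly :=
  \big[madd/mzero]_(j < n | (j <= i.+1)%N) mscale (a i j) (mX j).

Definition gens (d : 'I_n -> nat) (a : 'I_n -> 'I_n -> K) (i : 'I_n) : mpoly :=
  if n == 1%N then mpow (mX i) (d i).+1
  else mmul (mpow (mX i) (d i)) (lform a i).

End MPoly.

(* Main.v *)
(** Finite dimensionality of the quotient A means that choosing x_i or l_i for every i
    always gives independent linear forms.  Put c = sum d_i.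

    Surjectivity of l^(2m-c) onto degree m is proved by induction on the number of
    variables.  Rescaling all the variables but x_1 degenerates A to an algebra with the
    relations x_j^(d_j) l_j restricted to x_1 = 0, x_1^(d_1+...+d_(t-1)) x_t for t <= s, and
    x_1^(d_1+...+d_s+1), where s is the first index whose superdiagonal coefficient
    a_(s,s+1) vanishes.  In the filtration of this algebra by the ideals (x_2, ..., x_t),
    every graded piece is a quotient of some K[x_1]/(x_1^e) tensor B, with B of the same
    shape as A in fewer variables, and all these tensor products are symmetric about the
    same degree; in characteristic 0 they inherit the Lefschetz property from B.  Since
    surjectivity is an open condition, it passes from the degeneration to A.

    Injectivity follows because the socle of A lies in degree c: if l^(c-2i) p = 0 in A
    with p of degree i, then p kills l^(c-2i) A_i = A_(c-i), so p = 0.  The socle is found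
    by splitting off linear factors along 0 -> R/(g, f) -> R/(x g, f) -> R/(x, f) -> 0,
    which is exact because products of independent linear forms are regular. *)
Require Import Defs.
From HB Require Import structures.
From mathcomp Require Import all_boot all_order all_algebra.
From mathcomp Require Import ring zify.
From mathcomp.multinomials Require Import mpoly.
From Stdlib Require Classical_Prop.
Import GRing.Theory.
Set Implicit Arguments. Unset Strict Implicit. Unset Printing Implicit Defensive.
Local Open Scope ring_scope.

(** * A spanning lemma for univariate polynomials *)

(** Surjectivity, unlike injectivity, passes to quotients and to extensions, so the induction only
    has to know that an ideal contains the expected relations. This matters because the graded
    pieces are colon ideals whose full sets of relations are never computed, and no Hilbert
    functions are compared. For the same reason degrees are labels on expressions in chosen
    generators of an arbitrary commutative ring, and the degenerate algebra may live in R[X] over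
    the ring R at hand. Taking the colon by y_t lowers d_t by one, possibly to zero; the induction
    therefore admits exponent zero for the first remaining variable, whose relation is then linear
    and eliminates it. One linear form has to serve all the pieces at once, so Lefschetz elements
    are sought as generic linear combinations, with genericity tested on lines of parameters only.
    Characteristic zero enters twice: through derivatives in the two-variable case, and through the
    infinitude of K whenever a good parameter is chosen. *)

Section UnivariatePolynomials.

Variable K : fieldType.
Hypothesis charK : [pchar K] =i pred0.

Lemma natr_eq0_pchar0 k : (k%:R == 0 :> K) = (k == 0%N).
Proof. exact: (pcharf0P K).1. Qed.

Lemma poly_nonroot (p : {poly K}) : p != 0 -> exists x, p.[x] != 0.
Proof.
move=> p0; pose rs := [seq i%:R : K | i <- iota 0 (size p)].
have rsU : uniq rs.
  rewrite map_inj_in_uniq ?iota_uniq // => i j _ _.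
  wlog le_ij : i j / (i <= j)%N => [hw|].
    by case/orP: (leq_total i j) => /hw // h e; rewrite h.
  move=> e; have := natr_eq0_pchar0 (j - i); rewrite natrB // e subrr eqxx => /esym/eqP; lia.
have /allPn[x _ nroot] : ~~ all (root p) rs; last by exists x.
apply/negP => /(max_poly_roots p0)/(_ rsU).
by rewrite size_map size_iota ltnn.
Qed.

Lemma size_derivn_eq0 (p : {poly K}) c : p^`(c) = 0 -> (size p <= c)%N.
Proof.
move=> pc0; apply/leq_sizeP => j le_cj.
have := coef0 K (j - c); rewrite -pc0 coef_derivn subnKC // -mulr_natr.
by move/eqP; rewrite mulf_eq0 natr_eq0_pchar0 -leqn0 leqNgt ffact_gt0 le_cj orbF => /eqP.
Qed.

Lemma dvdp_exp_deriv (q p : {poly K}) b : q ^+ b.+1 %| p -> q ^+ b %| p^`().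
Proof.
case/dvdpP=> r ->; rewrite derivM deriv_exp /= dvdp_addr.
  by rewrite -mulrnAl mulrA dvdp_mull.
by rewrite exprS mulrA dvdp_mull.
Qed.

Lemma dvdp_exp_derivn (q p : {poly K}) b c : q ^+ (b + c) %| p -> q ^+ b %| p^`(c).
Proof.
elim: c p => [|c IHc] p; first by rewrite addn0 derivn0.
by rewrite addnS derivSn => /dvdp_exp_deriv/IHc.
Qed.

Let coprime_expX1 i j : coprimep ('X ^+ i : {poly K}) (('X - 1) ^+ j).
Proof.
apply/coprimep_expl/coprimep_expr.
by rewrite -[1]polyC1 coprimep_XsubC rootX oner_eq0.
Qed.

(* Applying the c-th derivative kills C, and what is left of the relation is a
   polynomial of size at most a + b divisible by X^b (X - 1)^a. *)
Lemma poly_three_powers_free a b c (A B C : {poly K}) :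
    (size A <= a)%N -> (size B <= b)%N -> (size C <= c)%N ->
  'X ^+ (b + c) * A + ('X - 1) ^+ (a + c) * B + C = 0 ->
  [/\ A = 0, B = 0 & C = 0].
Proof.
move=> sA sB sC rel; have sX1 k : size (('X - 1) ^+ k : {poly K}) = k.+1.
  by rewrite -[1]polyC1 size_exp_XsubC.
have nX1 : 'X - 1 != 0 :> {poly K} by rewrite -size_poly_gt0 -[_ - _]expr1 sX1.
have [U defU] : {U | U = ('X ^+ (b + c) * A)^`(c)} by eexists.
have [V defV] : {V | V = (('X - 1) ^+ (a + c) * B)^`(c)} by eexists.
have UV : U = - V.
  apply/eqP; rewrite -addr_eq0 defU defV; move/(congr1 (derivn c)): rel.
  by rewrite !derivnD (derivn_poly0 sC) addr0 (derivn_poly0 (p := 0)) ?size_poly0 // => /eqP.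
have dU : 'X ^+ b * ('X - 1) ^+ a %| U.
  rewrite Gauss_dvdp ?coprime_expX1 // {1}defU dvdp_exp_derivn ?dvdp_mulr //=.
  by rewrite UV defV dvdpNr dvdp_exp_derivn ?dvdp_mulr.
have sW : size ('X ^+ b * ('X - 1) ^+ a : {poly K}) = (a + b).+1.
  by rewrite size_mul ?expf_neq0 ?polyX_eq0 // size_polyXn sX1 /=; lia.
have U0 : U = 0.
  apply/eqP; apply/negPn/negP => /(dvdp_leq)/(_ dU); rewrite sW.
  have: (size U <= size ('X ^+ (b + c) * A)%R - c)%N.
    apply/leq_sizeP => j hj; by rewrite defU coef_derivn nth_default ?mul0rn // -leq_subLR.
  have [->|A0] := eqVneq A 0; first by rewrite mulr0 size_poly0; move: (size U); lia.
  rewrite size_mul ?expf_neq0 ?polyX_eq0 // size_polyXn; move: (size U) (size A) sA; lia.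
have A0 : A = 0.
  apply/eqP/negPn/negP => A0; move: U0; rewrite defU => /size_derivn_eq0.
  rewrite size_mul ?expf_neq0 ?polyX_eq0 // size_polyXn.
  by move: A0; rewrite -size_poly_gt0; move: (size A); lia.
have B0 : B = 0.
  have V0 : V = 0 by apply/eqP; rewrite -oppr_eq0 -UV U0.
  apply/eqP/negPn/negP => B0; move: V0; rewrite defV => /size_derivn_eq0.
  rewrite size_mul ?expf_neq0 // sX1.
  by move: B0; rewrite -size_poly_gt0; move: (size B); lia.
by split=> //; move: rel; rewrite A0 B0 !mulr0 !add0r.
Qed.

(** Freeness makes (A, B, C) an injective endomorphism of a space of dimension a + b + c, hence
    onto. With x = ['X], y = 1 - ['X], so that x + y = 1, this is the dehomogenized statement that
    every form of degree a + b + c - 1 lies in (x^(b+c), y^(a+c), (x+y)^(a+b)). *)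
Lemma poly_three_powers a b c (P : {poly K}) : (size P <= a + b + c)%N ->
  exists A B C : {poly K}, [/\ (size A <= a)%N, (size B <= b)%N, (size C <= c)%N &
    P = 'X ^+ (b + c) * A + (1 - 'X) ^+ (a + c) * B + C].
Proof.
move=> sP.
pose A (v : 'rV[K]_(a + b + c)) := rVpoly (lsubmx (lsubmx v)).
pose B (v : 'rV[K]_(a + b + c)) := rVpoly (rsubmx (lsubmx v)).
pose C (v : 'rV[K]_(a + b + c)) := rVpoly (rsubmx v).
pose E v := 'X ^+ (b + c) * A v + ('X - 1) ^+ (a + c) * B v + C v.
have sA v : (size (A v) <= a)%N by apply: size_poly.
have sB v : (size (B v) <= b)%N by apply: size_poly.
have sC v : (size (C v) <= c)%N by apply: size_poly.
have sE v : (size (E v) <= a + b + c)%N.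
  have s1 := size_polyMleq 'X^(b + c) (A v).
  have s2 := size_polyMleq (('X - 1) ^+ (a + c)) (B v).
  rewrite size_polyXn in s1; rewrite -[1]polyC1 size_exp_XsubC in s2.
  rewrite (leq_trans (size_polyD _ _)) // geq_max (leq_trans (size_polyD _ _)) ?geq_max /=.
    by apply: leq_trans (sC v) _; rewrite leq_addl.
  rewrite (leq_trans s1) /= ?(leq_trans s2) //; [move: (sB v) | move: (sA v)];
    by move: (size _); lia.
have linE : linear (poly_rV \o E : _ -> 'rV_(a + b + c)).
  move=> k u v; rewrite /= -linearP /=; congr poly_rV.
  by rewrite /E /A /B /C !linearP /= !mulrDr -!scalerAr -!mul_polyC; ring.
pose f : {linear 'rV_(a + b + c) -> 'rV_(a + b + c)} :=
  HB.pack (poly_rV \o E : _ -> 'rV_(a + b + c)) (GRing.isLinear.Build _ _ _ _ _ linE).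
have inj : row_free (lin1_mx f).
  apply: inj_row_free => v; rewrite mul_rV_lin1 /= => /(congr1 rVpoly).
  rewrite poly_rV_K // linear0 => /(poly_three_powers_free (sA v) (sB v) (sC v)) [].
  move=> /(congr1 (@poly_rV K a)) + /(congr1 (@poly_rV K b)) + /(congr1 (@poly_rV K c)).
  rewrite !rVpolyK !linear0 => l r d.
  by rewrite -[v]hsubmxK -[lsubmx v]hsubmxK l r d !row_mx0.
pose v := poly_rV P *m invmx (lin1_mx f).
have : poly_rV (E v) = poly_rV P :> 'rV_(a + b + c).
  by rewrite -[LHS]/(f v) -mul_rV_lin1 mulmxKV // -row_free_unit.
move/(congr1 rVpoly); rewrite !poly_rV_K // => <-.
exists (A v), ((-1) ^+ (a + c) * B v), (C v); split=> //.
  by rewrite -signr_odd; case: odd; rewrite ?mulN1r ?size_polyN ?mul1r.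
by rewrite /E mulrA -exprMn mulrN1 opprB.
Qed.

End UnivariatePolynomials.

(** * Forms, graded ideals and the Lefschetz property *)

Section Forms.

Variables (F R : comNzRingType) (phi : {rmorphism F -> R}).
Implicit Types (G : R -> Prop) (I : nat -> R -> Prop).

(** Degree belongs to an expression in the elements of [G], which may satisfy relations. Changes of
    generators and evaluation of a parameter thus preserve forms by a plain induction. *)
Inductive form G : nat -> R -> Prop :=
| form_const c : form G 0 (phi c)
| form_zero m : form G m 0
| form_add m p q of form G m p & form G m q : form G m (p + q)
| form_gen m x p of G x & form G m p : form G m.+1 (x * p).

Lemma form_scale G m c p : form G m p -> form G m (phi c * p).
Proof.
elim=> {m p} [k|m|m p q _ fp _ fq|m x p Gx _ fp].
- by rewrite -rmorphM; apply: form_const.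
- by rewrite mulr0; apply: form_zero.
- by rewrite mulrDr; apply: form_add.
- by rewrite mulrCA; apply: form_gen.
Qed.

Lemma form_opp G m p : form G m p -> form G m (- p).
Proof. by move/(form_scale (-1)); rewrite rmorphN1 mulN1r. Qed.

Lemma form_one G : form G 0 1.
Proof. by rewrite -(rmorph1 phi); apply: form_const. Qed.

Lemma form_lin G x : G x -> form G 1 x.
Proof. by move=> Gx; rewrite -[x]mulr1; apply: form_gen => //; apply: form_one. Qed.

Lemma form_sum G m (T : Type) (r : seq T) (P : pred T) (f : T -> R) :
  (forall t, P t -> form G m (f t)) -> form G m (\sum_(t <- r | P t) f t).
Proof.
by move=> ff; elim/big_ind: _ => // *; [apply: form_zero | apply: form_add].
Qed.

Lemma form_mul G m p k q : form G m p -> form G k q -> form G (m + k) (p * q).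
Proof.
move=> fp fq; elim: fp => {m p} [c|m|m p p' _ fp _ fp'|m x p Gx _ fp].
- exact: form_scale.
- by rewrite mul0r; apply: form_zero.
- by rewrite mulrDl; apply: form_add.
- by rewrite -mulrA addSn; apply: form_gen.
Qed.

Lemma form_exp G m p k : form G m p -> form G (m * k) (p ^+ k).
Proof.
by move=> fp; elim: k => [|k IH]; rewrite ?muln0 ?mulnS ?exprS;
  [apply: form_one | apply: form_mul].
Qed.

Lemma form_pow G l k : form G 1 l -> form G k (l ^+ k).
Proof. by move/(form_exp k); rewrite mul1n. Qed.

Lemma form_trans G H m p :
  (forall x, G x -> form H 1 x) -> form G m p -> form H m p.
Proof.
move=> GH; elim=> {m p} [c|m|m p q _ fp _ fq|m x p Gx _ fp].
- exact: form_const.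
- exact: form_zero.
- exact: form_add.
- by rewrite -add1n; apply: form_mul => //; apply: GH.
Qed.

Lemma form_sub G H m p : (forall x, G x -> H x) -> form G m p -> form H m p.
Proof. by move=> GH; apply: form_trans => x /GH; apply: form_lin. Qed.

(* p is a form of degree c - m, where negative degrees only contain 0. *)
Definition formz G c m p := if (m <= c)%N then form G (c - m) p else p = 0.

Lemma formz_add G c m p q : formz G c m p -> formz G c m q -> formz G c m (p + q).
Proof. by rewrite /formz; case: leqP => _; [apply: form_add | move=> -> ->; rewrite addr0]. Qed.

Lemma formz_zero G c m : formz G c m 0.
Proof. by rewrite /formz; case: leqP => // _; apply: form_zero. Qed.

(* I m is the degree m part; R itself carries no grading. *)
Record graded_ideal G I : Prop := GradedIdeal {
  gideal0 : forall m, I m 0;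
  gidealD : forall m p q, I m p -> I m q -> I m (p + q);
  gidealZ : forall m c p, I m p -> I m (phi c * p);
  gidealM : forall m x p, G x -> I m p -> I m.+1 (x * p) }.

Section GradedIdeal.
Variables (G : R -> Prop) (I : nat -> R -> Prop).
Hypothesis gI : graded_ideal G I.

Lemma gideal_opp m p : I m p -> I m (- p).
Proof. by move/(gidealZ gI (-1)); rewrite rmorphN1 mulN1r. Qed.

Lemma gideal_sub m p q : I m p -> I m q -> I m (p - q).
Proof. by move=> Ip /gideal_opp; apply: (gidealD gI). Qed.

Lemma gideal_mul m k p q : form G m p -> I k q -> I (m + k) (p * q).
Proof.
move=> fp Iq; elim: fp => {m p} [c|m|m p p' _ fp _ fp'|m x p Gx _ fp].
- exact: (gidealZ gI).
- by rewrite mul0r; apply: (gideal0 gI).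
- by rewrite mulrDl; apply: (gidealD gI).
- by rewrite -mulrA addSn; apply: (gidealM gI).
Qed.

Lemma gideal_sum m (T : Type) (r : seq T) (P : pred T) (f : T -> R) :
  (forall t, P t -> I m (f t)) -> I m (\sum_(t <- r | P t) f t).
Proof.
by move=> ff; elim/big_ind: _ => // *; [apply: (gideal0 gI) | apply: (gidealD gI)].
Qed.

Lemma gideal_congr m p q : I m (p - q) -> I m q -> I m p.
Proof. by move=> /(gidealD gI)/[apply]; rewrite subrK. Qed.

Lemma graded_ideal_sub H : (forall x, H x -> form G 1 x) -> graded_ideal H I.
Proof.
move=> HG; case: (gI) => i0 iD iZ _; split=> // m x p Hx Ip.
by rewrite -add1n; apply: gideal_mul => //; apply: HG.
Qed.

Lemma form_vanish c m p : (forall q, form G c q -> I c q) -> (c <= m)%N ->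
  form G m p -> I m p.
Proof.
move=> top le_cm fp; elim: fp le_cm => {m p} [k|m|m p q _ IHp _ IHq|m x p Gx fp IH] le_cm.
- by move: le_cm top; rewrite leqn0 => /eqP-> top; apply/top/form_const.
- exact: (gideal0 gI).
- by apply: (gidealD gI); [apply: IHp | apply: IHq].
move: le_cm; rewrite leq_eqVlt => /orP[/eqP ec|/IH]; last exact: (gidealM gI).
by move: top; rewrite ec => top; apply/top/form_gen.
Qed.

End GradedIdeal.

(* Only surjectivity is required; for m > c the conclusion is that p lies in I. *)
Definition lefschetz G I c l := forall m, (c <= 2 * m)%N -> forall p, form G m p ->
  exists q, formz G c m q /\ I m (p - l ^+ (2 * m - c) * q).

End Forms.

(** * The Lefschetz property in two variables *)

Section TwoVariables.

Variables (K : fieldType) (R : comNzRingType) (phi : {rmorphism K -> R}).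
Hypothesis charK : [pchar K] =i pred0.
Variables z g : R.

(** Homogenization in degree m, sending ['X] to z and 1 to g + z; hence 1 - ['X] goes to g. *)
Let H m (P : {poly K}) := \sum_(i < m.+1) phi P`_i * (z ^+ i * (g + z) ^+ (m - i)).

Let HD m (P Q : {poly K}) : H m (P + Q) = H m P + H m Q.
Proof. by rewrite -big_split; apply: eq_bigr => i _; rewrite /= coefD rmorphD mulrDl. Qed.

Let H_X m (Q : {poly K}) : H m.+1 ('X * Q) = z * H m Q.
Proof.
rewrite /H big_ord_recl coefXM rmorph0 mul0r add0r mulr_sumr.
by apply: eq_bigr => i _; rewrite coefXM /= subSS exprS; ring.
Qed.

Let H_1 m (Q : {poly K}) : (size Q <= m.+1)%N -> H m.+1 Q = (g + z) * H m Q.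
Proof.
move=> sQ; rewrite /H big_ord_recr /= nth_default // rmorph0 mul0r addr0 mulr_sumr.
apply: eq_bigr => i _; rewrite subSn -1?ltnS // exprS; ring.
Qed.

Let H_Xn n m (Q : {poly K}) : H (n + m) ('X ^+ n * Q) = z ^+ n * H m Q.
Proof.
by elim: n => [|n IH]; rewrite ?expr0 ?mul1r // addSn !exprS -!mulrA H_X IH.
Qed.

Let H_1n n m (Q : {poly K}) : (size Q <= m.+1)%N -> H (n + m) Q = (g + z) ^+ n * H m Q.
Proof.
move=> sQ; elim: n => [|n IH]; rewrite ?expr0 ?mul1r // addSn exprS -mulrA H_1 ?IH //.
by move: (size Q) sQ; lia.
Qed.

Let size_1Xn n m (Q : {poly K}) : (size Q <= m.+1)%N ->
  (size ((1 - 'X) ^+ n * Q)%R <= (n + m).+1)%N.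
Proof.
move=> sQ; apply: leq_trans (size_polyMleq _ _) _.
have -> : 1 - 'X = - ('X - 1%:P) :> {poly K} by rewrite polyC1 opprB.
rewrite exprNn -signr_odd.
have -> : size ((-1) ^+ odd n * ('X - 1%:P) ^+ n : {poly K}) = n.+1.
  by case: odd; rewrite ?mulN1r ?size_polyN ?mul1r size_exp_XsubC.
by move: (size Q) sQ; lia.
Qed.

Let H_1Xn n m (Q : {poly K}) : (size Q <= m.+1)%N ->
  H (n + m) ((1 - 'X) ^+ n * Q) = g ^+ n * H m Q.
Proof.
move=> sQ; elim: n => [|n IH]; rewrite ?expr0 ?mul1r // addSn !exprS -!mulrA -IH.
set Q' := (1 - 'X) ^+ n * Q.
have -> : (1 - 'X) * Q' = Q' + 'X * (-1 * Q') by ring.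
by rewrite HD H_X H_1 ?size_1Xn // -[in RHS](addrK z g) mulrBl; congr (_ + _);
  rewrite -mulrN /H -sumrN; congr (_ * _); apply: eq_bigr => i _;
  rewrite mulN1r coefN rmorphN mulNr.
Qed.

Let G x := x = z \/ x = g.

Let formH m P : form phi G m (H m P).
Proof.
apply: form_sum => i _; apply: form_scale; rewrite -{1}(subnKC (ltn_ord i : (i <= m)%N)).
apply: form_mul; apply: form_pow; first by apply: form_lin; left.
by apply: form_add; apply: form_lin; [right | left].
Qed.

(* The strong Lefschetz property of K[z, g]/(z^e, g^f), which needs characteristic 0. *)
Lemma two_variable_lefschetz e f k i j : (e + f + k = 2 * (i + j) + 2)%N ->
  exists A B C, [/\ formz phi G (i + j) e A, formz phi G (i + j) f B,
    formz phi G (i + j) k C & z ^+ i * g ^+ j = z ^+ e * A + g ^+ f * B + (g + z) ^+ k * C].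
Proof.
move=> deg; set m := (i + j)%N in deg *.
(* Up to truncation, a, b, c are m+1-e, m+1-f, m+1-k, the dimensions of the forms of degree m
   divisible by z^e, g^f, (g+z)^k in independent variables; by [deg] they add up to m+1. The minimum
   keeps this sum right when k > m+1. *)
pose a := (m.+1 - e)%N; pose b := minn (m.+1 - f) (m.+1 - a); pose c := (m.+1 - a - b)%N.
have sP : (size ('X ^+ i * (1 - 'X) ^+ j : {poly K})%R <= a + b + c)%N.
  have -> : (a + b + c = m.+1)%N by rewrite /c /b /a; lia.
  apply: leq_trans (size_polyMleq _ _) _; rewrite size_polyXn.
  have := @size_1Xn j 0 1; rewrite size_poly1 mulr1 addn0 => /(_ isT).
  by rewrite /m; move: (size _); lia.
have [A [B [C [sA sB sC defP]]]] := poly_three_powers charK sP.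
have Hm : z ^+ i * g ^+ j = H m ('X ^+ i * (1 - 'X) ^+ j).
  rewrite H_Xn; have := @H_1Xn j 0 1; rewrite size_poly1 addn0 mulr1 => -> //.
  by rewrite /H big_ord1 coef1 rmorph1 !mulr1.
have part (Q P' : {poly K}) n s k' w : (s <= m.+1 - k')%N -> (n + s = m.+1)%N ->
    form phi G 1 w -> (size Q <= s)%N -> (Q = 0 -> P' = 0) ->
    (forall t, (size Q <= t.+1)%N -> H (n + t) P' = w ^+ n * H t Q) ->
  exists2 A', formz phi G m k' A' & H m P' = w ^+ k' * A'.
  case: s => [|s] sk ns fw sQ P'0 HP'; last first.
    exists (w ^+ (n - k') * H s Q).
      rewrite /formz ifT; last by lia.
      have -> : (m - k' = n - k' + s)%N by lia.
      by apply: form_mul => //; apply: form_pow.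
    rewrite mulrA -exprD subnKC; last by lia.
    by rewrite -HP' //; congr H; lia.
  exists 0; first exact: formz_zero.
  rewrite P'0; last by apply/eqP; rewrite -size_poly_leq0.
  by rewrite mulr0 /H big1 // => t _; rewrite coef0 rmorph0 mul0r.
have fz : form phi G 1 z by apply: form_lin; left.
have fg : form phi G 1 g by apply: form_lin; right.
have [||A0|t sA'|A' fA EA] := part A ('X ^+ (b + c) * A) (b + c)%N a e z _ _ fz sA.
- by rewrite /a; lia.
- by rewrite /c /b /a; lia.
- by rewrite A0 mulr0.
- exact: H_Xn.
have [||B0|t sB'|B' fB EB] := part B ((1 - 'X) ^+ (a + c) * B) (a + c)%N b f g _ _ fg sB.
- by rewrite /b; lia.
- by rewrite /c /b /a; lia.
- by rewrite B0 mulr0.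
- exact: H_1Xn.
have [||C0|t sC'|C' fC EC] := part C C (a + b)%N c k (g + z) _ _ (form_add fg fz) sC.
- by rewrite /c /b /a; lia.
- by rewrite /c /b /a; lia.
- exact: C0.
- exact: H_1n.
by exists A', B', C'; split=> //; rewrite Hm defP !HD -EA -EB -EC.
Qed.

End TwoVariables.

(** * Primitive decomposition and tensor products *)

Section Tensor.

Variables (K : fieldType) (R : comNzRingType) (phi : {rmorphism K -> R}).
Hypothesis charK : [pchar K] =i pred0.
Implicit Types (G : R -> Prop) (I : nat -> R -> Prop).
Local Notation form := (form phi).
Local Notation formz := (formz phi).
Local Notation graded_ideal := (graded_ideal phi).
Local Notation lefschetz := (lefschetz phi).

(* The Lefschetz decomposition: modulo I, every form is a sum of terms g^i p
   with p primitive. *)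
Lemma primitive_ind G I c g (Q : nat -> R -> Prop) :
    graded_ideal G I -> form G 1 g -> lefschetz G I c g ->
    (forall m p q, Q m p -> Q m q -> Q m (p + q)) ->
    (forall m p, I m p -> Q m p) ->
    (forall l i p, form G l p -> (2 * l <= c)%N ->
       I (c.+1 - l)%N (g ^+ (c.+1 - 2 * l) * p) -> Q (l + i)%N (g ^+ i * p)) ->
  forall m p, form G m p -> Q m p.
Proof.
move=> gI fg lef QD QI Qprim m p fp.
suff: forall i, Q (m + i)%N (g ^+ i * p).
  by move/(_ 0%N); rewrite addn0 expr0 mul1r.
elim/ltn_ind: m p fp => m IH p fp i.
have gIi q k n : (n = k + i)%N -> I k q -> Q n (g ^+ i * q).
  by move=> -> Iq; apply: QI; rewrite addnC; apply: (gideal_mul gI) (form_pow i fg) Iq.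
have [le_mc|lt_cm] := leqP (2 * m) c.
  (* Surjectivity onto degree c+1-m writes g^(c+1-2m) p as g^(c+2-2m) q modulo I with q of degree
     m-1. So p - g q is primitive, and g q is left to the induction, which is why the claim carries
     a power g^i. *)
  have [||q [fq Iq]] := lef (c.+1 - m)%N _ (g ^+ (c.+1 - 2 * m) * p); first by lia.
    have -> : (c.+1 - m = c.+1 - 2 * m + m)%N by lia.
    by apply: form_mul => //; apply: form_pow.
  have primitive r : form G m (p - r) ->
      g ^+ (c.+1 - 2 * m) * r = g ^+ (2 * (c.+1 - m) - c) * q ->
      Q (m + i)%N (g ^+ i * (p - r)).
    by move=> fpr e; apply: Qprim => //; rewrite mulrBr e.
  case: m => [|m] in IH fp le_mc fq Iq primitive gIi *.
    move: fq; rewrite /formz ifF; last by lia.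
    by move=> q0; rewrite -[p]subr0; apply: primitive; rewrite ?subr0 // q0 !mulr0.
  move: fq; rewrite /formz ifT; last by lia.
  have -> : (c - (c.+1 - m.+1) = m)%N by lia.
  move=> fq; rewrite -[p](subrK (g * q)) mulrDr; apply: QD.
    apply: primitive => //.
      by apply: form_add => //; apply: form_opp; rewrite -add1n; apply: form_mul.
    by rewrite mulrA -exprSr; congr (_ ^+ _ * _); lia.
  by rewrite mulrA -exprSr addSnnS; apply: IH.
have [|q [fq Iq]] := lef m _ p fp; first by lia.
rewrite -[p](subrK (g ^+ (2 * m - c) * q)) mulrDr; apply: QD; first exact: gIi Iq.
move: fq; rewrite /formz; case: leqP => [le_mc fq|_ ->].
  rewrite mulrA -exprD; have -> : (m + i = c - m + (i + (2 * m - c)))%N by lia.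
  by apply: IH => //; lia.
by rewrite !mulr0; apply: QI; apply: (gideal0 gI).
Qed.

(** Every such form is a sum of terms z^i p with p a form in [G]; the prefix z^i r carried by the
    induction sorts the factors. *)
Lemma form_adjoin_ind G z (Q : nat -> R -> Prop) :
    (forall m p q, Q m p -> Q m q -> Q m (p + q)) -> (forall m, Q m 0) ->
    (forall i m p, form G m p -> Q (i + m)%N (z ^+ i * p)) ->
  forall m p, form (fun x => x = z \/ G x) m p -> Q m p.
Proof.
move=> QD Q0 Qz m p fp.
suff: forall i j r, form G j r -> Q (m + (i + j))%N (z ^+ i * r * p).
  by move/(_ 0%N 0%N 1 (form_one phi G)); rewrite !addn0 expr0 !mul1r.
elim: fp => {m p} [c|m|m p q _ IHp _ IHq|m x p Gx _ IH] i j r fr.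
- by rewrite -mulrA [r * _]mulrC add0n; apply: Qz; apply: form_scale.
- by rewrite mulr0.
- by rewrite mulrDr; apply: QD; [apply: IHp | apply: IHq].
case: Gx => [->|Gx].
  have -> : (m.+1 + (i + j) = m + (i.+1 + j))%N by lia.
  have -> : z ^+ i * r * (z * p) = z ^+ i.+1 * r * p by rewrite exprS; ring.
  exact: IH.
have -> : (m.+1 + (i + j) = m + (i + j.+1))%N by lia.
have -> : z ^+ i * r * (x * p) = z ^+ i * (x * r) * p by ring.
by apply: IH; apply: form_gen.
Qed.

(* If z^e = 0, the algebra generated by G and z is a quotient of the tensor product
   with K[z]/(z^e). *)
Lemma lefschetz_adjoin G I z g c e d : (d.+1 = c + e)%N ->
    graded_ideal (fun x => x = z \/ G x) I -> form G 1 g -> lefschetz G I c g ->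
    I e (z ^+ e) ->
  lefschetz (fun x => x = z \/ G x) I d (g + z).
Proof.
move=> de gI fg lef Iz; set G' := fun x => _.
have GG' x : G x -> G' x by right.
have gIG : graded_ideal G I by apply: (graded_ideal_sub gI) => x Gx; apply: form_lin; right.
have fz : form G' 1 z by apply: form_lin; left.
have fg' : form G' 1 g by apply: form_sub fg.
pose good m p := (d <= 2 * m)%N ->
  exists q, formz G' d m q /\ I m (p - (g + z) ^+ (2 * m - d) * q).
have goodD m p q : good m p -> good m q -> good m (p + q).
  move=> gp gq /[dup] /gp[p' [fp' Ip']] /gq[q' [fq' Iq']].
  exists (p' + q'); split; first exact: formz_add.
  by rewrite mulrDr opprD addrACA; apply: (gidealD gI).
have goodI m p : I m p -> good m p.
  by move=> Ip _; exists 0; split; [apply: formz_zero | rewrite mulr0 subr0].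
suff goodP m p : form G' m p -> good m p.
  by move=> n le_dn q /goodP/(_ le_dn).
move: m p; apply: form_adjoin_ind => [//|m'|i m' p' fp']; first by apply: goodI; apply: (gideal0 gI).
pose Q m p := good (i + m)%N (z ^+ i * p).
apply: (@primitive_ind G I c g Q) fp' => // {m' p'} [m p q Qp Qq|m p Ip|l j p fp le_lc Ip].
- by rewrite /Q mulrDr; apply: goodD.
- by apply: goodI; apply: (gideal_mul gI _ Ip); apply: form_pow.
move=> le_d; set k := (2 * _ - d)%N.
(* On a primitive p of degree l both z^e and g^(c+1-2l) act as zero, so the two-variable identity
   leaves only the multiple of (g+z)^k. The degree count holds for every l: all these strings have
   the same centre. *)
have [|A [B [C [fA fB fC EABC]]]] :=
    @two_variable_lefschetz K R phi charK z g e (c.+1 - 2 * l) k i j.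
  by rewrite /k; lia.
have GG x : x = z \/ x = g -> form G' 1 x by case=> ->.
have fz' n A' : formz (fun x => x = z \/ x = g) (i + j) n A' -> formz G' (i + j) n A'.
  by rewrite /formz; case: leqP => // _; apply: form_trans.
exists (C * p); split.
  move: fC => /fz'; rewrite /formz; case: leqP => [le_kij fC|_ ->].
    rewrite ifT; last by rewrite /k in le_kij; lia.
    have -> : (d - (i + (l + j)) = i + j - k + l)%N by rewrite /k; lia.
    by apply: form_mul => //; apply: form_sub fp.
  by rewrite mul0r; case: ifP => // _; apply: form_zero.
have -> : z ^+ i * (g ^+ j * p) - (g + z) ^+ k * (C * p) =
    A * p * z ^+ e + B * (g ^+ (c.+1 - 2 * l) * p) by rewrite mulrA EABC; ring.
apply: (gidealD gI).
  move: fA => /fz'; rewrite /formz; case: leqP => [le_e fA|_ ->]; last first.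
    by rewrite !mul0r; apply: (gideal0 gI).
  have -> : (i + (l + j) = (i + j - e + l) + e)%N by lia.
  by apply: (gideal_mul gI _ Iz); apply: form_mul => //; apply: form_sub fp.
move: fB => /fz'; rewrite /formz; case: leqP => [le_e fB|_ ->]; last first.
  by rewrite !mul0r; apply: (gideal0 gI).
have -> : (i + (l + j) = (i + j - (c.+1 - 2 * l)) + (c.+1 - l))%N by lia.
exact: (gideal_mul gI fB Ip).
Qed.

End Tensor.

(** * Specialization of a parameter *)

Section Monomials.

Variables (F R : comNzRingType) (phi : {rmorphism F -> R}) (ys : seq R).

Fixpoint monomials m : seq R :=
  if m is m'.+1 then [seq y * u | y <- ys, u <- monomials m'] else [:: 1].

Lemma form_monomials m p : p \in monomials m -> form phi (fun x => x \in ys) m p.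
Proof.
elim: m p => [|m IH] p /=; first by rewrite inE => /eqP->; apply: form_one.
by case/allpairsP=> -[y u] /= [yys /IH fu ->]; apply: form_gen.
Qed.

Lemma form_span m p : form phi (fun x => x \in ys) m p ->
  exists c : 'I_(size (monomials m)) -> F, p = \sum_i phi (c i) * (monomials m)`_i.
Proof.
elim=> {m p} [c|m|m p q _ [c ->] _ [d ->]|m x p xys _ [c ->]].
- by exists (fun=> c); rewrite /= big_ord1 mulr1.
- by exists (fun=> 0); rewrite big1 // => i _; rewrite rmorph0 mul0r.
- exists (fun i => c i + d i); rewrite -big_split; apply: eq_bigr => i _.
  by rewrite rmorphD mulrDl.
rewrite mulr_sumr.
have mem v : v \in monomials m.+1 -> exists d : 'I_(size (monomials m.+1)) -> F,
    forall k, phi k * v = \sum_j phi (d j * k) * (monomials m.+1)`_j.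
  move=> vs; have lt_i : (index v (monomials m.+1) < size (monomials m.+1))%N.
    by rewrite index_mem.
  exists (fun j => (j == Ordinal lt_i)%:R) => k.
  rewrite (bigD1 (Ordinal lt_i)) //= eqxx mul1r nth_index // big1 ?addr0 // => j /negPf->.
  by rewrite mul0r rmorph0 mul0r.
have /fin_all_exists[d dE] (i : 'I_(size (monomials m))) :=
  mem (x * (monomials m)`_i) (allpairs_f _ xys (mem_nth 0 (ltn_ord i))).
exists (fun j => \sum_i d i j * c i).
under eq_bigr => i _ do rewrite mulrCA dE.
rewrite exchange_big; apply: eq_bigr => j _; rewrite rmorph_sum mulr_suml.
by [].
Qed.

End Monomials.

Section Specialization.

Variables (K : fieldType) (R : comNzRingType) (phi : {rmorphism K -> R}).

(** The special fibre is a K-algebra and uses [const_scalar]; the family over the line has scalars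
    K[X] and uses [poly_scalar]. *)
Definition const_scalar : {rmorphism K -> {poly R}} := polyC \o phi.
Definition poly_scalar : {rmorphism {poly K} -> {poly R}} := map_poly phi.

Variable ys : seq {poly R}.
Let G (x : {poly R}) := x \in ys.
Let Gs s (x : R) := x \in [seq y.[phi s] | y <- ys].

Lemma form_const_poly m p : form const_scalar G m p -> form poly_scalar G m p.
Proof.
elim=> {m p} [c|m|m p q _ fp _ fq|m x p Gx _ fp].
- have -> : const_scalar c = poly_scalar c%:P by rewrite /= map_polyC.
  exact: form_const.
- exact: form_zero.
- exact: form_add.
- exact: form_gen.
Qed.

Lemma form_eval m p s : form poly_scalar G m p -> form phi (Gs s) m p.[phi s].
Proof.
elim=> {m p} [c|m|m p q _ fp _ fq|m x p Gx _ fp].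
- by rewrite /= horner_map; apply: form_const.
- by rewrite horner0; apply: form_zero.
- by rewrite hornerD; apply: form_add.
- by rewrite hornerM; apply: form_gen => //; apply: map_f.
Qed.

Lemma form_lift m p s : form phi (Gs s) m p ->
  exists2 P, form const_scalar G m P & p = P.[phi s].
Proof.
elim=> {m p} [c|m|m p q _ [P fP ->] _ [Q fQ ->]|m x p Gx _ [P fP ->]].
- exists (const_scalar c); first exact: form_const.
  by rewrite /= hornerC.
- by exists 0; rewrite ?horner0 //; apply: form_zero.
- by exists (P + Q); rewrite ?hornerD //; apply: form_add.
- case/mapP: Gx => y Gy ->; exists (y * P); rewrite ?hornerM //; exact: form_gen.
Qed.

(* The ideal I[X] + ('X) of R[X], read on forms in ys. *)
Definition poly_ideal (I : nat -> R -> Prop) m (p : {poly R}) :=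
  exists2 u, form poly_scalar G m u & forall i, I m (p - 'X * u)`_i.

Variable I : nat -> R -> Prop.
Hypothesis gI : forall s, graded_ideal phi (Gs s) I.

Let I_eval s m (p : {poly R}) : (forall i, I m p`_i) -> I m p.[phi s].
Proof.
move=> Ip; rewrite horner_coef; apply: (gideal_sum (gI 0)) => i _.
by rewrite mulrC -rmorphXn; apply: (gidealZ (gI 0)).
Qed.

(* Nakayama's lemma in its determinant form: a relation holding modulo 'X holds
   at every s outside the zeros of a nonzero polynomial. *)
Lemma specialize_relation m k (w : {poly R}) :
    (forall p, form const_scalar G m p ->
       exists2 q, form poly_scalar G k q & poly_ideal I m (p - w * q)) ->
  exists2 Phi : {poly K}, Phi != 0 & forall s, Phi.[s] != 0 ->
    forall p, form phi (Gs s) m p ->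
    exists2 q, form phi (Gs s) k q & I m (p - w.[phi s] * q).
Proof.
move=> rel; pose N := size (monomials ys m); pose tau (a : 'I_N) := (monomials ys m)`_a.
have ftau a : form const_scalar G m (tau a) by apply: form_monomials; apply: mem_nth.
(* Each monomial tau_a equals w q_a + ['X] u_a modulo I[X]. Expanding u_a in the monomials over K[X]
   gives (1 - ['X] M) tau = w q, which the adjugate solves up to a determinant with constant term
   1. *)
have [q fq /fin_all_exists2[u fu Iu]] := fin_all_exists2 (fun a => rel _ (ftau a)).
have /fin_all_exists[M ME] a : exists c : 'I_N -> {poly K}, u a = \sum_b poly_scalar (c b) * tau b.
  exact: form_span (fu a).
pose A : 'M[{poly K}]_N := \matrix_(a, b) ((a == b)%:R - 'X * M a b).
have detA0 : (\det A).[0] = 1.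
  rewrite -[LHS]/(horner_eval 0 (\det A)) -det_map_mx.
  rewrite (_ : map_mx _ A = 1%:M) ?det1 //; apply/matrixP => a b.
  rewrite !mxE /= /horner_eval hornerD hornerN hornerM hornerX mul0r subr0.
  by rewrite -[in LHS]polyC_natr hornerC.
exists (\det A) => [|s nz p /form_lift[P /form_span[c ->] ->]].
  by apply/eqP => A0; move/eqP: detA0; rewrite A0 horner0 eq_sym oner_eq0.
pose T := \col_a tau a; pose V := \col_b (tau b - 'X * u b).
have AT : map_mx poly_scalar A *m T = V.
  apply/colP => b; rewrite !mxE ME mulr_sumr -[tau b in RHS]mul1r -(rmorph1 poly_scalar).
  under eq_bigr => a _ do rewrite !mxE rmorphB rmorphM /= map_polyX mulrBl -mulrA.
  rewrite sumrB; congr (_ - _); rewrite (bigD1 b) //= eqxx big1 ?addr0 // => a /negPf.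
  by rewrite eq_sym => ->; rewrite rmorph0 mul0r.
have detT a : phi (\det A).[s] * (tau a).[phi s] =
    \sum_b phi (\adj A a b).[s] * (tau b - 'X * u b).[phi s].
  have : (map_mx poly_scalar (\adj A) *m V) a 0 = poly_scalar (\det A) * tau a.
    by rewrite -AT mulmxA -map_mxM mul_adj_mx map_scalar_mx mul_scalar_mx !mxE.
  move/(congr1 (horner_eval (phi s))); rewrite mxE /horner_eval hornerM /= horner_map => <-.
  by rewrite horner_sum; apply: eq_bigr => b _; rewrite !mxE hornerM /= horner_map.
exists (\sum_a phi (c a / (\det A).[s]) * \sum_b phi (\adj A a b).[s] * (q b).[phi s]).
  apply: form_sum => a _; apply: form_scale; apply: form_sum => b _; apply: form_scale.
  exact: form_eval.
rewrite horner_sum mulr_sumr -sumrB; apply: (gideal_sum (gI 0)) => a _.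
have -> : (const_scalar (c a) * tau a).[phi s] =
    phi (c a / (\det A).[s]) * (phi (\det A).[s] * (tau a).[phi s]).
  by rewrite mulrA -rmorphM divfK // hornerM hornerC.
rewrite detT mulrCA -mulrBr; apply: (gidealZ (gI 0)).
rewrite mulr_sumr -sumrB; apply: (gideal_sum (gI 0)) => b _.
rewrite mulrCA -mulrBr; apply: (gidealZ (gI 0)).
rewrite -!hornerM -hornerN -hornerD addrAC; apply: I_eval => i; exact: Iu.
Qed.

Lemma lefschetz_specialize c (l : {poly R}) :
    form poly_scalar G 1 l -> lefschetz const_scalar G (poly_ideal I) c l ->
  exists2 Phi : {poly K}, Phi != 0 & forall s, Phi.[s] != 0 ->
    lefschetz phi (Gs s) I c l.[phi s].
Proof.
move=> fl lef.
have rel m : (c <= 2 * m)%N -> exists2 Phi : {poly K}, Phi != 0 & forall s, Phi.[s] != 0 ->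
    forall p, form phi (Gs s) m p ->
    exists q, formz phi (Gs s) c m q /\ I m (p - l.[phi s] ^+ (2 * m - c) * q).
  (* For m > c the quotient q must be 0 and the claim is that p lies in I; w = 0 expresses this as a
     relation of the same kind. *)
  move=> le_c2m; pose w := if (m <= c)%N then l ^+ (2 * m - c) else 0.
  have [|Phi Phi0 PhiP] := @specialize_relation m (c - m) w.
    move=> p /(lef m le_c2m)[q [fq Iq]]; exists q; move: fq Iq.
      rewrite /formz; case: leqP => _; first by move=> ? _; apply: form_const_poly.
      by move=> -> _; apply: form_zero.
    by rewrite /formz /w; case: leqP => // _ ->; rewrite !mulr0.
  exists Phi => // s /PhiP{}PhiP p /PhiP[q fq Iq].
  exists (if (m <= c)%N then q else 0); move: Iq; rewrite /formz /w; case: leqP => // _ Iq; split=> //.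
    by rewrite -horner_exp.
  by move: Iq; rewrite horner0 mul0r mulr0.
(* Degrees up to c+1 suffice: in degree c+1 all forms lie in I, and [form_vanish] propagates this
   upwards. So one product of finitely many polynomials works. *)
have [Phi Phi0 PhiP] : exists2 Phi : {poly K}, Phi != 0 & forall s, Phi.[s] != 0 ->
    forall m, (m < c.+2)%N -> (c <= 2 * m)%N -> forall p, form phi (Gs s) m p ->
    exists q, formz phi (Gs s) c m q /\ I m (p - l.[phi s] ^+ (2 * m - c) * q).
  elim: (c.+2) => [|m [Phi Phi0 PhiP]]; first by exists 1; rewrite ?oner_eq0.
  have [le|gt] := leqP c (2 * m); last first.
    exists Phi => // s nz m'; rewrite ltnS leq_eqVlt => /orP[/eqP->|/PhiP]; last exact.
    by rewrite leqNgt gt.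
  have [Psi Psi0 PsiP] := rel m le; exists (Phi * Psi); first by rewrite mulf_neq0.
  move=> s; rewrite hornerM mulf_eq0 negb_or => /andP[n1 n2] m'.
  by rewrite ltnS leq_eqVlt => /orP[/eqP-> _|/PhiP]; [apply: PsiP | apply].
exists Phi => // s nz m le_c2m p fp.
have [|lt_cm] := ltnP m c.+2; first by move/PhiP; apply.
exists 0; split; first exact: formz_zero.
rewrite mulr0 subr0; apply: (form_vanish (gI s) _ (ltnW lt_cm) fp) => q.
move=> /(PhiP s nz c.+1 (ltnSn _))[|r []]; first by lia.
by rewrite /formz ifF => [->|]; [rewrite mulr0 subr0 | lia].
Qed.

End Specialization.

(** * Generic Lefschetz elements *)

Section Genericity.

Variables (K : fieldType) (R : comNzRingType) (phi : {rmorphism K -> R}).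

(** This is [lefschetz_specialize] for a constant family: the generators do not involve ['X], only
    the linear form l0 + ['X] l1 moves. *)
Lemma lefschetz_line (ys : seq R) I c l0 l1 :
    graded_ideal phi (fun x => x \in ys) I ->
    form phi (fun x => x \in ys) 1 l0 -> form phi (fun x => x \in ys) 1 l1 ->
    lefschetz phi (fun x => x \in ys) I c l0 ->
  exists2 Phi : {poly K}, Phi != 0 & forall s, Phi.[s] != 0 ->
    lefschetz phi (fun x => x \in ys) I c (l0 + phi s * l1).
Proof.
move=> gI f0 f1 lef; pose yh := map polyC ys; pose Gh x := x \in yh.
have yhK s : [seq y.[phi s] | y <- yh] = ys.
  by rewrite -map_comp map_id_in // => y _; rewrite /= hornerC.
have fC m p : form phi (fun x => x \in ys) m p -> form (const_scalar phi) Gh m p%:P.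
  elim=> {m p} [k|m|m p q _ fp _ fq|m x p xys _ fp].
  - exact: form_const.
  - exact: form_zero.
  - by rewrite polyCD; apply: form_add.
  - by rewrite polyCM; apply: form_gen => //; apply: map_f.
pose l := l0%:P + 'X * l1%:P.
have fX m p : form (poly_scalar phi) Gh m p -> form (poly_scalar phi) Gh m ('X * p).
  by move=> fp; have := form_scale 'X fp; rewrite /= map_polyX.
have fl : form (poly_scalar phi) Gh 1 l.
  by apply: form_add; [|apply: fX]; apply/form_const_poly/fC.
have lX k : exists2 u, form (poly_scalar phi) Gh k u & l ^+ k = (l0 ^+ k)%:P + 'X * u.
  elim: k => [|k [u fu E]]; first by exists 0; [apply: form_zero | rewrite mulr0 addr0].
  exists (l1%:P * (l0 ^+ k)%:P + l * u).
    rewrite -add1n; apply: form_add; apply: form_mul => //; apply/form_const_poly/fC => //.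
    exact: form_pow.
  by rewrite exprS E /l exprS polyCM; ring.
have [||Phi Phi0 PhiP] := @lefschetz_specialize K R phi yh I _ c l fl.
- by move=> s; rewrite yhK.
- move=> m le_c2m P fP.
  have [p fp ->] : exists2 p, form phi (fun x => x \in ys) m p & P = p%:P.
    elim: fP => {m P le_c2m} [k|m|m p q _ [p' fp ->] _ [q' fq ->]|m x p xys _ [p' fp ->]].
    - by exists (phi k); first exact: form_const.
    - by exists 0; first exact: form_zero.
    - by exists (p' + q'); rewrite ?polyCD //; apply: form_add.
    - by case/mapP: xys => y yys ->; exists (y * p'); rewrite ?polyCM //; apply: form_gen.
  have [q [fq Iq]] := lef m le_c2m p fp; exists q%:P; split.
    by move: fq; rewrite /formz; case: leqP => [_ /fC|_ ->].
  have [u fu ->] := lX (2 * m - c)%N; exists (- (u * q%:P)).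
    apply: form_opp; move: fq; rewrite /formz; case: leqP => [le_mc fq|_ ->].
      have -> : (m = (2 * m - c) + (c - m))%N by lia.
      by apply: form_mul => //; apply/form_const_poly/fC.
    by rewrite polyC0 mulr0; apply: form_zero.
  move=> i; have -> : p%:P - ((l0 ^+ (2 * m - c))%:P + 'X * u) * q%:P - 'X * - (u * q%:P) =
      (p - l0 ^+ (2 * m - c) * q)%:P by rewrite polyCB polyCM; ring.
  by rewrite coefC; case: eqP => // _; apply: (gideal0 gI).
exists Phi => // t /PhiP; rewrite yhK /l hornerD hornerM hornerX !hornerC; apply.
Qed.

(** Zariski openness tested on lines, which needs only one-variable polynomials. Quantifying over
    every eps that agrees pointwise with the point of the line avoids functional extensionality. *)
Definition line_open (P : (nat -> K) -> Prop) := forall gamma delta, P gamma ->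
  exists2 Phi : {poly K}, Phi != 0 & forall s eps, Phi.[s] != 0 ->
    (forall i, eps i = gamma i + s * delta i) -> P eps.

Lemma line_open_all (P : nat -> (nat -> K) -> Prop) (ts : seq nat) :
  (forall t, t \in ts -> line_open (P t)) ->
  line_open (fun gamma => forall t, t \in ts -> P t gamma).
Proof.
elim: ts => [|t ts IH] oP gamma delta Pg; first by exists 1; rewrite ?oner_eq0.
have [|u uts|Phi Phi0 PhiP] := IH _ gamma delta.
- by move=> u uts; apply: oP; rewrite inE uts orbT.
- by apply: Pg; rewrite inE uts orbT.
have [Psi Psi0 PsiP] := oP t (mem_head _ _) gamma delta (Pg t (mem_head _ _)).
exists (Phi * Psi) => [|s eps]; first by rewrite mulf_neq0.
rewrite hornerM mulf_eq0 negb_or => /andP[n1 n2] E u; rewrite inE => /orP[/eqP->|].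
  exact: PsiP n2 E.
exact: PhiP n1 E u.
Qed.

Hypothesis charK : [pchar K] =i pred0.

(* Each condition is generic on the line joining two parameters, so two satisfiable
   conditions are satisfiable together. *)
Lemma line_open_common (P : nat -> (nat -> K) -> Prop) (ts : seq nat) :
    (forall t, t \in ts -> line_open (P t)) ->
    (forall t, t \in ts -> exists gamma, P t gamma) ->
  exists gamma, forall t, t \in ts -> P t gamma.
Proof.
elim: ts => [|t ts IH] oP eP; first by exists (fun=> 0).
have oP' u : u \in ts -> line_open (P u) by move=> uts; apply: oP; rewrite inE uts orbT.
have [|gamma Pg] := IH oP'; first by move=> u uts; apply: eP; rewrite inE uts orbT.
have [delta Pd] := eP t (mem_head _ _).
have [Phi Phi0 PhiP] := line_open_all oP' (fun i => delta i - gamma i) Pg.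
have [Psi Psi0 PsiP] := oP t (mem_head _ _) delta (fun i => gamma i - delta i) Pd.
(* Psi parametrizes the line from its other end delta, so the parameter s there becomes 1 - s. *)
have Psi1 : Psi \Po (1 - 'X) != 0.
  apply: contraNneq Psi0 => /(congr1 (fun p => p \Po (1 - 'X))).
  by rewrite -comp_polyA comp_polyB comp_polyC comp_polyX comp_poly0 opprB addrC subrK comp_polyXr => ->.
have [s] := poly_nonroot charK (mulf_neq0 Phi0 Psi1).
rewrite hornerM mulf_eq0 negb_or horner_comp hornerD hornerN hornerX hornerC => /andP[n1 n2].
exists (fun i => gamma i + s * (delta i - gamma i)) => u; rewrite inE => /orP[/eqP->|uts].
  by apply: PsiP n2 _ => i; ring.
exact: PhiP n1 _ u uts.
Qed.

Definition vars k r (y : nat -> R) (x : R) := x \in [seq y i | i <- index_iota k r].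
Definition lincomb k r (gamma : nat -> K) (y : nat -> R) :=
  \sum_(k <= i < r) phi (gamma i) * y i.

Lemma varsP k r y x : vars k r y x <-> exists2 i, (k <= i < r)%N & x = y i.
Proof.
split=> [/mapP[i]|[i ki ->]]; first by rewrite mem_index_iota; exists i.
by apply: map_f; rewrite mem_index_iota.
Qed.

Lemma form_var k r y i : (k <= i < r)%N -> form phi (vars k r y) 1 (y i).
Proof. by move=> ki; apply/form_lin/varsP; exists i. Qed.

Lemma form_lincomb k r gamma y : form phi (vars k r y) 1 (lincomb k r gamma y).
Proof.
rewrite /lincomb big_seq; apply: form_sum => i; rewrite mem_index_iota => ki.
exact/form_scale/form_var.
Qed.

Lemma lefschetz_line_open k r y I c : graded_ideal phi (vars k r y) I ->
  line_open (fun gamma => lefschetz phi (vars k r y) I c (lincomb k r gamma y)).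
Proof.
move=> gI gamma delta lef.
have [Phi Phi0 PhiP] := lefschetz_line gI (form_lincomb k r gamma y) (form_lincomb k r delta y) lef.
exists Phi => // s eps /PhiP; rewrite /lincomb mulr_sumr -big_split => + E.
by under eq_bigr => i _ do rewrite /= mulrA -rmorphM -mulrDl -rmorphD -E.
Qed.

End Genericity.

(** * The degenerate algebra *)

Section Congruence.

Variables (F R : comNzRingType) (phi : {rmorphism F -> R}).
Implicit Types (G H : R -> Prop) (I : nat -> R -> Prop).

Lemma form_reduce G H I m p : graded_ideal phi G I ->
    (forall x, G x -> exists2 x', form phi H 1 x' & I 1%N (x - x')) ->
    (forall x, H x -> form phi G 1 x) -> form phi G m p ->
  exists2 p', form phi H m p' & I m (p - p').
Proof.
move=> gI GH HG; elim=> {m p} [c|m|m p q _ [p' fp Ip] _ [q' fq Iq]|m x p Gx fp [p' fp' Ip]].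
- by exists (phi c); [apply: form_const | rewrite subrr; apply: (gideal0 gI)].
- by exists 0; [apply: form_zero | rewrite subrr; apply: (gideal0 gI)].
- exists (p' + q'); first exact: form_add.
  by rewrite opprD addrACA; apply: (gidealD gI).
have [x' fx' Ix] := GH x Gx; exists (x' * p'); first by rewrite -add1n; apply: form_mul.
have -> : x * p - x' * p' = p * (x - x') + x' * (p - p') by ring.
apply: (gidealD gI); first by rewrite -addn1; apply: (gideal_mul gI).
by rewrite -add1n; apply: (gideal_mul gI) => //; apply: form_trans fx'.
Qed.

Lemma gideal_exp G I m l l' n : graded_ideal phi G I ->
    form phi G m l -> form phi G m l' -> I m (l - l') -> I (m * n)%N (l ^+ n - l' ^+ n).
Proof.
move=> gI fl fl' Il; elim: n => [|n IH].
  by rewrite muln0 subrr; apply: (gideal0 gI).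
have -> : l ^+ n.+1 - l' ^+ n.+1 = l * (l ^+ n - l' ^+ n) + l' ^+ n * (l - l').
  by rewrite !exprS; ring.
rewrite mulnS; apply: (gidealD gI); first exact: (gideal_mul gI).
by rewrite addnC; apply: (gideal_mul gI) => //; apply: form_exp.
Qed.

(* Lefschetz elements may be computed after eliminating generators modulo I. *)
Lemma lefschetz_reduce G H I c l l' : graded_ideal phi G I ->
    (forall x, G x -> exists2 x', form phi H 1 x' & I 1%N (x - x')) ->
    (forall x, H x -> form phi G 1 x) ->
    form phi G 1 l -> form phi G 1 l' -> I 1%N (l - l') ->
  lefschetz phi H I c l' -> lefschetz phi G I c l.
Proof.
move=> gI GH HG fl fl' Il lef m le_c2m p /(form_reduce gI GH HG)[p' fp' Ip].
have [q [fq Iq]] := lef m le_c2m p' fp'.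
have fq' : formz phi G c m q.
  by move: fq; rewrite /formz; case: leqP => // _; apply: form_trans.
exists q; split=> //; set n := (2 * m - c)%N in Iq *.
have -> : p - l ^+ n * q = (p - p') + (p' - l' ^+ n * q) + (- q) * (l ^+ n - l' ^+ n) by ring.
apply: (gidealD gI); first exact: (gidealD gI).
move: fq'; rewrite /formz; case: leqP => [le_mc fq'|_ ->]; last first.
  by rewrite oppr0 mul0r; apply: (gideal0 gI).
have -> : (m = c - m + n)%N by rewrite /n; lia.
apply: (gideal_mul gI); first exact: form_opp.
by have := gideal_exp n gI fl fl' Il; rewrite mul1n.
Qed.

End Congruence.

Section Band.

Variables (K : fieldType).
Hypothesis charK : [pchar K] =i pred0.

(* l_j, where only x_k, ..., x_(r-1) are kept and y_i is substituted for x_i. *)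
Definition band (R : comNzRingType) (phi : K -> R) (a : nat -> nat -> K) k r (y : nat -> R) j :=
  \sum_(k <= i < r | (i <= j.+1)%N) phi (a j i) * y i.

(** Phrased on points instead of minors: dropping the first variables amounts to extending v by
    zeros, and eliminating a variable to extending v by the solved coordinate. *)
Definition nondegenerate (a : nat -> nat -> K) k r := forall v : nat -> K,
  (forall j, (k <= j < r)%N -> v j = 0 \/ band idfun a k r v j = 0) ->
  forall j, (k <= j < r)%N -> v j = 0.

Section Degenerate.

Variables (R : comNzRingType) (phi : {rmorphism K -> R}).
Variables (k s r : nat) (d : nat -> nat) (a : nat -> nat -> K) (y : nat -> R).
Variable J : nat -> R -> Prop.
Local Notation G := (vars k r y).
Local Notation deg t := (\sum_(k <= j < t) d j)%N.
Local Notation tot t := (\sum_(t <= j < r) d j)%N.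

Hypothesis ks : (k <= s < r)%N.
Hypothesis d_gt0 : forall j, (k <= j < r)%N -> (0 < d j)%N.
Hypothesis gJ : graded_ideal phi G J.
Hypothesis J_band : forall j, (k < j < r)%N ->
  J (d j).+1 (y j ^+ d j * band phi a k.+1 r y j).
Hypothesis J_mixed : forall t, (k < t <= s)%N -> J (deg t).+1 (y k ^+ deg t * y t).
Hypothesis J_pure : J (deg s.+1).+1 (y k ^+ (deg s.+1).+1).
(** The induction hypothesis. The exponent d' t may be zero, as happens after dividing the relation
    of y_t by y_t when d t = 1. *)
Hypothesis tails : forall t d' I, (k < t <= r)%N ->
  (forall j, (t < j < r)%N -> 0 < d' j)%N ->
  graded_ideal phi (vars t r y) I ->
  (forall j, (t <= j < r)%N -> I (d' j).+1 (y j ^+ d' j * band phi a t r y j)) ->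
  exists gamma, lefschetz phi (vars t r y) I (\sum_(t <= j < r) d' j) (lincomb phi t r gamma y).

Let vars_sub t x : (k <= t)%N -> vars t r y x -> G x.
Proof. by move=> kt /varsP[i ti ->]; apply/varsP; exists i => //; lia. Qed.

(* J + (y_{k+1}, ..., y_{t-1}) *)
Let Jplus t m p := exists2 h : nat -> R, forall i, formz phi G m 1 (h i) &
  J m (p - \sum_(k.+1 <= i < t) y i * h i).

Let Jplus_sub t m p : J m p -> Jplus t m p.
Proof.
move=> Jp; exists (fun=> 0) => [i|]; first exact: formz_zero.
by rewrite big1 ?subr0 // => i _; rewrite mulr0.
Qed.

Let gJplus t : graded_ideal phi G (Jplus t).
Proof.
split=> [m|m p q [h fh Jp] [h' fh' Jq]|m c p [h fh Jp]|m x p Gx [h fh Jp]].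
- exact/Jplus_sub/(gideal0 gJ).
- exists (fun i => h i + h' i) => [i|]; first exact: formz_add.
  under eq_bigr => i _ do rewrite mulrDr.
  by rewrite big_split opprD addrACA; apply: (gidealD gJ).
- exists (fun i => phi c * h i) => [i|].
    by have := fh i; rewrite /formz; case: ifP => _; [apply: form_scale | move->; rewrite mulr0].
  under eq_bigr => i _ do rewrite mulrCA.
  by rewrite -mulr_sumr -mulrBr; apply: (gidealZ gJ).
exists (fun i => x * h i) => [i|].
  have := fh i; rewrite /formz /= subn1 /=; case: m {Jp fh} => [->|m]; last first.
    by rewrite subn1 /=; apply: form_gen.
  by rewrite mulr0; apply: form_zero.
under eq_bigr => i _ do rewrite mulrCA.
by rewrite -mulr_sumr -mulrBr; apply: (gidealM gJ).
Qed.

Let Jplus_var t i m q : (k < i < t)%N -> form phi G m q -> Jplus t m.+1 (y i * q).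
Proof.
move=> ki fq; exists (fun j => if j == i then q else 0) => [j|].
  rewrite /formz subn1; case: eqP => // _; exact: form_zero.
rewrite (bigD1_seq i) ?iota_uniq ?mem_index_iota //= eqxx big1 ?addr0 ?subrr; first exact: (gideal0 gJ).
by move=> j /negPf->; rewrite mulr0.
Qed.

(* The graded piece generated by y_t, as a colon ideal; the last piece, t = s + 1, is
   the quotient by (y_(k+1), ..., y_s). *)
Let piece t := if (t <= s)%N then fun m q => Jplus t m.+1 (y t * q) else Jplus t.
(** The colon by y_t turns the relation y_t^(d_t) l_t into y_t^(d_t - 1) l_t, which costs one
    degree. *)
Let socle t := if (t <= s)%N then (tot t).-1 else tot t.

Let gpiece t : (k < t <= s.+1)%N -> graded_ideal phi G (piece t).
Proof.
rewrite /piece; case: (leqP t s) => // le_ts kt.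
have gt := gJplus t; have Gt : G (y t) by apply/varsP; exists t => //; lia.
split=> [m|m p q|m c p|m x p Gx].
- by rewrite mulr0; apply: (gideal0 gt).
- by rewrite mulrDr; apply: (gidealD gt).
- by rewrite mulrCA; apply: (gidealZ gt).
- by rewrite mulrCA; apply: (gidealM gt).
Qed.

Let Jplus_piece t m p : (k < t <= s.+1)%N -> Jplus t m p -> piece t m p.
Proof.
rewrite /piece; case: (leqP t s) => // le_ts kt; apply: (gidealM (gJplus t)).
by apply/varsP; exists t => //; lia.
Qed.

Let Jplus_band t j : (k < t)%N -> (t <= j < r)%N ->
  Jplus t (d j).+1 (y j ^+ d j * band phi a t r y j).
Proof.
move=> kt tj; have /J_band J_j : (k < j < r)%N by lia.
have -> : y j ^+ d j * band phi a t r y j = y j ^+ d j * band phi a k.+1 r y j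
    - y j ^+ d j * \sum_(k.+1 <= i < t | (i <= j.+1)%N) phi (a j i) * y i.
  rewrite /band (big_cat_nat (n := t) (m := k.+1)) //=; [ring | lia].
apply: (gideal_sub (gJplus t)); first exact: Jplus_sub.
rewrite mulr_sumr big_seq_cond; apply: (gideal_sum (gJplus t)) => i.
rewrite mem_index_iota => /andP[ki _]; rewrite mulrCA; apply: (gidealZ (gJplus t)).
by rewrite mulrC; apply: Jplus_var => //; apply/form_pow/form_var; lia.
Qed.

Let piece_generic t : (k < t <= s.+1)%N ->
  exists gamma, lefschetz phi (vars t r y) (piece t) (socle t) (lincomb phi t r gamma y).
Proof.
move=> kt; have gp := gpiece kt.
have gp' : graded_ideal phi (vars t r y) (piece t).
  by apply: (graded_ideal_sub gp) => x /vars_sub Gx; apply/form_lin/Gx; lia.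
have band_piece j : (t <= j < r)%N -> piece t (d j).+1 (y j ^+ d j * band phi a t r y j).
  by move=> tj; apply: Jplus_piece => //; apply: Jplus_band => //; lia.
have [le_ts|lt_st] := leqP t s; last first.
  rewrite /socle leqNgt lt_st /=; apply: tails => //; first by lia.
  by move=> j tj; apply: d_gt0; lia.
pose d' j := if j == t then (d t).-1 else d j.
have -> : socle t = (\sum_(t <= j < r) d' j)%N.
  rewrite /socle le_ts big_ltn ?[RHS]big_ltn; try lia.
  rewrite /d' eqxx; have : (0 < d t)%N by apply: d_gt0; lia.
  case: (d t) => // ? _; rewrite addSn /=; congr addn; apply: eq_big_nat => j tj; rewrite ifF //; lia.
apply: tails => //; first by lia.
  by move=> j tj; rewrite /d' ifF; [apply: d_gt0 | ]; lia.
move=> j tj; rewrite /d'; case: eqP => [->|_]; last exact: band_piece.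
have dt : (0 < d t)%N by apply: d_gt0; lia.
rewrite /piece le_ts mulrA -exprS prednK //; apply: Jplus_band; lia.
Qed.

Let l_ gamma := y k + lincomb phi k.+1 r gamma y.

Let fl gamma : form phi G 1 (l_ gamma).
Proof.
apply: form_add; first by apply: form_var; lia.
by apply: form_sub (form_lincomb _ _ _ _ _) => x; apply: vars_sub.
Qed.

(** In the piece, y_(k+1), ..., y_(t-1) vanish, which leaves y_k adjoined to the tail. For t <= s
    the piece sits one degree higher in the algebra, so [(tot k).-2] has the same centre as
    [tot k]. *)
Let piece_lefschetz t gamma : (k < t <= s.+1)%N ->
    lefschetz phi (vars t r y) (piece t) (socle t) (lincomb phi t r gamma y) ->
  lefschetz phi G (piece t) (if (t <= s)%N then (tot k).-2 else tot k) (l_ gamma).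
Proof.
move=> kt lef; have gp := gpiece kt.
pose H x := x = y k \/ vars t r y x.
have HG x : H x -> G x.
  by case=> [->|/vars_sub Gx]; [apply/varsP; exists k => //; lia | apply: Gx; lia].
have totE : tot k = (deg t + tot t)%N by rewrite -big_cat_nat //; lia.
(* The power of y_k that vanishes on the piece, supplied by [J_mixed] for t <= s and by [J_pure] for
   the last piece. *)
pose e := if (t <= s)%N then deg t else (deg s.+1).+1.
apply: (@lefschetz_reduce _ _ _ G H _ _ _ (lincomb phi t r gamma y + y k)) => //.
- move=> x /varsP[i ki ->]; have [le_ti|lt_it] := leqP t i.
    exists (y i); last by rewrite subrr; apply: (gideal0 gp).
    by apply: form_lin; right; apply/varsP; exists i => //; lia.
  have [->|ne_ik] := eqVneq i k.
    by exists (y k); [apply: form_lin; left | rewrite subrr; apply: (gideal0 gp)].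
  exists 0; first exact: form_zero.
  apply: Jplus_piece => //; rewrite subr0 -[y i]mulr1.
  by apply: Jplus_var; [lia | apply: form_one].
- by move=> x /HG Gx; apply: form_lin.
- by apply: form_add; [apply: form_sub (form_lincomb _ _ _ _ _) => x; apply: vars_sub | apply: form_var]; lia.
- have -> : l_ gamma - (lincomb phi t r gamma y + y k) = \sum_(k.+1 <= i < t) y i * phi (gamma i).
    rewrite /l_ /lincomb (big_cat_nat (n := t) (m := k.+1)) //=; try lia.
    by under [X in _ = X]eq_bigr => i _ do rewrite mulrC; ring.
  apply: Jplus_piece => //; rewrite big_seq; apply: (gideal_sum (gJplus t)) => i.
  by rewrite mem_index_iota => ki; apply: Jplus_var => //; apply: form_const.
apply: (lefschetz_adjoin charK (c := socle t) (e := e)) => //.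
- rewrite /socle /e; case: leqP => ts; last first.
    have -> : s.+1 = t by lia.
    by rewrite totE; lia.
  have : (0 < tot t)%N.
    rewrite big_ltn; [have : (0 < d t)%N by apply: d_gt0; lia | lia]; lia.
  have : (0 < deg t)%N.
    rewrite big_ltn; [have : (0 < d k)%N by apply: d_gt0; lia | lia]; lia.
  by rewrite totE; lia.
- by apply: (graded_ideal_sub gp) => x /HG Gx; apply: form_lin.
- exact: form_lincomb.
rewrite /piece /e; case: leqP => ts; last exact: Jplus_sub.
by rewrite mulrC; apply/Jplus_sub/J_mixed; lia.
Qed.

(** Each piece has its own good gamma; openness on lines yields a common one, and surjectivity then
    lifts through the filtration. *)
Lemma lefschetz_degenerate : exists gamma,
  lefschetz phi G J (tot k) (y k + lincomb phi k.+1 r gamma y).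
Proof.
have [||gamma gammaP] := line_open_common charK (ts := index_iota k.+1 s.+2)
    (P := fun t gamma =>
       lefschetz phi (vars t r y) (piece t) (socle t) (lincomb phi t r gamma y)).
- move=> t; rewrite mem_index_iota => kt; apply: lefschetz_line_open.
  apply: (graded_ideal_sub (gpiece kt)) => x /vars_sub Gx; apply/form_lin/Gx; lia.
- by move=> t; rewrite mem_index_iota; apply: piece_generic.
exists gamma; rewrite -/(l_ gamma) => m le_c2m p fp.
have lefP t : (k < t <= s.+1)%N ->
    lefschetz phi G (piece t) (if (t <= s)%N then (tot k).-2 else tot k) (l_ gamma).
  by move=> kt; apply/piece_lefschetz/gammaP; rewrite ?mem_index_iota.
(* The error p - l^n q lies in J + (y_(k+1), ..., y_(s-u)). Each step removes the last variable y_t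
   by applying the Lefschetz property of its piece to the coefficient h_t. *)
have filt u : (u <= s - k)%N -> exists2 q, formz phi G (tot k) m q &
    Jplus (s.+1 - u) m (p - l_ gamma ^+ (2 * m - tot k) * q).
  elim: u => [|u IH] us.
    have := lefP s.+1; rewrite /piece ltnn subn0 => lefS.
    have [||q [fq Jq]] := lefS _ m _ p fp; [lia | exact: le_c2m | by exists q].
  have [|q fq] := IH; first by lia.
  set t := (s.+1 - u.+1)%N; have -> : (s.+1 - u = t.+1)%N by rewrite /t; lia.
  have kt : (k < t <= s)%N by rewrite /t; lia.
  case=> h fh Jh; rewrite big_nat_recr /= in Jh; last by lia.
  have hsum : Jplus t m (\sum_(k.+1 <= i < t) y i * h i).
    rewrite big_seq; apply: (gideal_sum (gJplus t)) => i; rewrite mem_index_iota => ki.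
    move: (fh i); rewrite /formz; case: ifP => [m_gt0|_ ->]; last first.
      by rewrite mulr0; apply: (gideal0 (gJplus t)).
    by move=> fi; rewrite -[m]prednK // -subn1; apply: Jplus_var.
  have := fh t; rewrite /formz; case: ifP => [m_gt0|_] fht; last first.
    exists q => //; rewrite fht mulr0 addr0 in Jh.
    exact: (gideal_congr (gJplus t) (Jplus_sub t Jh) hsum).
  have le_ts : (t <= s)%N by lia.
  have := lefP t; rewrite /piece le_ts.
  (* Both d k and d t count in [tot k], so [.-2] does not truncate and 2(m-1) - (tot k - 2) = 2m -
     tot k: the same power of l corrects p and h_t. *)
  have totk : (2 <= tot k)%N.
    have -> : tot k = (deg t + tot t)%N by rewrite -big_cat_nat //; lia.
    rewrite big_ltn; last by lia.
    rewrite [X in (_ + X)%N]big_ltn; last by lia.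
    have : (0 < d k)%N by apply: d_gt0; lia.
    have : (0 < d t)%N by apply: d_gt0; lia.
    by lia.
  move=> lefT; have [||q' [fq' Jq']] := lefT _ (m - 1)%N _ _ fht; [lia | lia |].
  exists (q + y t * q').
    apply: formz_add => //; move: fq'; rewrite /formz; case: leqP => [le_m fq'|_ ->]; last first.
      by rewrite mulr0; apply: (formz_zero phi G (tot k) m).
    rewrite ifT; last by lia.
    have -> : (tot k - m = ((tot k).-2 - (m - 1)).+1)%N by lia.
    by apply: form_gen => //; apply/varsP; exists t => //; lia.
  have Em : (m - 1).+1 = m by lia.
  have En : (2 * (m - 1) - (tot k).-2 = 2 * m - tot k)%N by lia.
  rewrite Em En in Jq'; set n := (2 * m - tot k)%N in Jh Jq' *.
  have -> : p - l_ gamma ^+ n * (q + y t * q') =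
     p - l_ gamma ^+ n * q - (\sum_(k.+1 <= i < t) y i * h i + y t * h t)
     + (\sum_(k.+1 <= i < t) y i * h i + y t * (h t - l_ gamma ^+ n * q')) by ring.
  apply: (gidealD (gJplus t)); first exact: Jplus_sub.
  by apply: (gidealD (gJplus t)) => //; exact: hsum.
have [|q fq] := filt (s - k)%N; first by [].
have -> : (s.+1 - (s - k) = k.+1)%N by lia.
by case=> h _; rewrite (big_geq (m := k.+1) (n := k.+1)) // subr0 => Jq; exists q.
Qed.

End Degenerate.
End Band.

(** * Lifting from the degeneration *)

Lemma graded_colon (F R : comNzRingType) (phi : {rmorphism F -> R}) G I n x :
  graded_ideal phi G I -> graded_ideal phi G (fun m q => I (n + m)%N (x * q)).
Proof.
move=> gI; split=> [m|m p q|m c p|m z p Gz].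
- by rewrite mulr0; apply: (gideal0 gI).
- by rewrite mulrDr; apply: (gidealD gI).
- by rewrite mulrCA; apply: (gidealZ gI).
- by rewrite mulrCA addnS; apply: (gidealM gI).
Qed.

Section Band.

Variables (K : fieldType).
Hypothesis charK : [pchar K] =i pred0.

Lemma band_ltn (R : comNzRingType) (phi : K -> R) a k r y j : (k < r)%N -> (k <= j.+1)%N ->
  band phi a k r y j = phi (a j k) * y k + band phi a k.+1 r y j.
Proof. by move=> kr kj; rewrite /band big_ltn_cond // kj. Qed.

Lemma band_diag (R : comNzRingType) (phi : {rmorphism K -> R}) a k r y :
  band phi a k.+1 r y k = phi (if (k.+1 < r)%N then a k k.+1 else 0) * y k.+1.
Proof.
have [kr|rk] := ltnP; last by rewrite /band big_geq // rmorph0 mul0r.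
rewrite band_ltn // /band big_seq_cond big1 ?addr0 // => i.
by rewrite mem_index_iota; lia.
Qed.

(** * Powers of the first variable modulo the relations *)

Section Powers.

Variables (R : comNzRingType) (phi : {rmorphism K -> R}).
Variables (k r : nat) (d : nat -> nat) (a : nat -> nat -> K) (y : nat -> R).
Variable I : nat -> R -> Prop.
Local Notation deg t := (\sum_(k <= j < t) d j)%N.

Hypothesis gI : graded_ideal phi (vars k r y) I.
Hypothesis nd : nondegenerate a k r.
Hypothesis I_band : forall j, (k <= j < r)%N -> I (d j).+1 (y j ^+ d j * band phi a k r y j).

(* mu is the solution of the linear forms l_k, ..., l_{t-1} with mu_k = 1. *)
Let solution t (mu : nat -> K) :=
  [/\ mu k = 1, forall i, (t < i)%N -> mu i = 0,
      forall j, (k <= j < t)%N -> band idfun a k r mu j = 0 &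
      forall i, (k <= i <= t)%N -> I (deg t).+1 (y k ^+ deg t * (y i - phi (mu i) * y k))].

(** After multiplication by y_k^(deg t), every y_i with i <= t may be replaced by mu_i y_k.
    Nondegeneracy forces mu_t to be nonzero, so y_t^(d_t) l_t turns into y_k^(d_t) l_t, where
    y_(t+1) is the only variable left to replace. *)
Let step t mu : (k <= t < r)%N -> solution t mu ->
  I (deg t.+1).+1 (y k ^+ deg t.+1 *
    (phi (band idfun a k r mu t) * y k + phi (if (t.+1 < r)%N then a t t.+1 else 0) * y t.+1)).
Proof.
move=> kt [muk mu0 bandmu Imu].
have mut : mu t != 0.
  apply: contra_eq_neq muk => mut; rewrite (@nd mu) 1?eq_sym ?oner_eq0 //; last by lia.
  move=> j kj; have [jt|tj] := ltnP j t; first by right; apply: bandmu; lia.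
  by left; move: tj; rewrite leq_eqVlt => /orP[/eqP<-|/mu0].
pose I' m q := I (deg t + m)%N (y k ^+ deg t * q).
have gI' : graded_ideal phi (vars k r y) I' by apply: graded_colon.
have fy i : (k <= i < r)%N -> form phi (vars k r y) 1 (y i) by apply: form_var.
have I1 i : (k <= i <= t)%N -> I' 1%N (y i - phi (mu i) * y k).
  by move=> ki; rewrite /I' addn1; apply: Imu.
have fuk i : form phi (vars k r y) 1 (phi (mu i) * y k) by apply/form_scale/fy; lia.
have fband : form phi (vars k r y) 1 (band phi a k r y t).
  rewrite /band big_seq_cond; apply: form_sum => i; rewrite mem_index_iota => /andP[ki _].
  exact/form_scale/fy.
have I2 : I' (d t).+1 (y k ^+ d t * band phi a k r y t).
  have -> : y k ^+ d t * band phi a k r y t = phi (mu t ^- d t) *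
     (y t ^+ d t * band phi a k r y t -
      band phi a k r y t * (y t ^+ d t - (phi (mu t) * y k) ^+ d t)).
    have E : phi (mu t ^- d t) * phi (mu t ^+ d t) = 1.
      by rewrite -rmorphM mulVf ?expf_neq0 // rmorph1.
    rewrite -[LHS]mul1r -[in LHS]E exprMn -rmorphXn /=; ring.
  apply: (gidealZ gI'); apply: (gideal_sub gI').
    by apply: (gideal_mul gI); [apply/form_pow/fy; lia | apply: I_band].
  rewrite -add1n; apply: (gideal_mul gI') => //.
  by have := gideal_exp (d t) gI' (fy t kt) (fuk t) (I1 t _); rewrite mul1n; apply; lia.
have -> : (deg t.+1 = deg t + d t)%N by rewrite big_nat_recr //; lia.
rewrite exprD -mulrA -addnS -/(I' _ _); set b := phi _ * y k + _.
have -> : y k ^+ d t * b = y k ^+ d t * band phi a k r y t -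
    y k ^+ d t * (band phi a k r y t - b) by ring.
apply: (gideal_sub gI') => //; rewrite -addn1; apply: (gideal_mul gI'); first by apply/form_pow/fy; lia.
have -> : band phi a k r y t - b =
    \sum_(k <= i < r | (i <= t.+1)%N) phi (a t i) * (y i - phi (mu i) * y k)
    - phi (if (t.+1 < r)%N then a t t.+1 else 0) * y t.+1.
  rewrite opprD addrA; congr (_ - _); rewrite /band rmorph_sum mulr_suml -sumrB.
  by apply: eq_bigr => i _; rewrite rmorphM mulrBr mulrA.
rewrite (big_cat_nat (n := t.+1)) //=; [|lia|lia].
rewrite -addrA; apply: (gidealD gI').
  rewrite big_seq_cond; apply: (gideal_sum gI') => i; rewrite mem_index_iota => /andP[ki _].
  by apply/(gidealZ gI')/I1; lia.
have [tr|rt] := ltnP; last by rewrite big_geq // rmorph0 mul0r subrr; apply: (gideal0 gI').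
rewrite big_ltn_cond // leqnn mu0 // rmorph0 mul0r subr0 addrC addKr.
rewrite big_seq_cond big1 ?subrr ?add0r; first exact: (gideal0 gI').
by move=> i; rewrite mem_index_iota; lia.
Qed.

Let solution_exists t : (k <= t < r)%N -> (forall j, (k <= j < t)%N -> a j j.+1 != 0) ->
  exists mu, solution t mu.
Proof.
have base : solution k (fun i => (i == k)%:R).
  split=> [|i ki|j|i ki]; rewrite ?eqxx //; first by rewrite gtn_eqF.
    by lia.
  have -> : i = k by lia.
  by rewrite eqxx rmorph1 mul1r subrr mulr0; apply: (gideal0 gI).
elim: t => [|t IH] kt a0.
  exists (fun i => (i == k)%:R); suff -> : 0%N = k by []; lia.
have [<-|ne_kt] := eqVneq k t.+1; first by exists (fun i => (i == k)%:R).
have [||mu sol] := IH; [lia | by move=> j kj; apply: a0; lia |].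
have := step _ sol; case: sol => muk mu0 bandmu Imu.
rewrite ifT; last by lia.
set lambda := band idfun a k r mu t => stepI.
have at0 : a t t.+1 != 0 by apply: a0; lia.
(* The new coordinate is the one forced by l_t = 0. *)
pose nu i := if i == t.+1 then - (lambda / a t t.+1) else mu i; exists nu.
have nuE i : (i <= t)%N -> nu i = mu i by rewrite /nu; case: eqP => // -> /=; rewrite ltnn.
have degE : (deg t.+1 = d t + deg t)%N by rewrite addnC big_nat_recr //; lia.
split=> [|i ti|j kj|i ki].
- by rewrite nuE //; lia.
- by rewrite /nu ifF ?mu0 //; lia.
- have [jt|tj] := ltnP j t.
    rewrite -(bandmu j) /band; last by lia.
    rewrite big_seq_cond [RHS]big_seq_cond; apply: eq_bigr => i /andP[_ ij].
    by rewrite nuE //; lia.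
  have -> : j = t by lia.
  have nuD i : nu i = mu i + (if i == t.+1 then - (lambda / a t t.+1) else 0).
    by rewrite /nu; case: eqP => [->|_]; rewrite ?addr0 // mu0 ?add0r.
  rewrite /band; under eq_bigr => i _ do rewrite nuD mulrDr.
  rewrite big_split -/(band idfun a k r mu t) -/lambda /=.
  rewrite [X in _ + X]big_mkcond (bigD1_seq t.+1) ?iota_uniq ?mem_index_iota //=.
  rewrite eqxx leqnn big1 ?addr0; last by move=> i /negPf->; rewrite mulr0 if_same.
  by rewrite mulrN mulrCA divff // mulr1 subrr.
have [it|ti] := leqP i t.
  rewrite nuE // degE -addnS exprD -mulrA.
  by apply: (gideal_mul gI); [apply: form_pow; apply: form_var; lia | apply: Imu; lia].
have -> : i = t.+1 by lia.
rewrite /nu eqxx.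
have -> : y k ^+ deg t.+1 * (y t.+1 - phi (- (lambda / a t t.+1)) * y k) =
   phi (a t t.+1)^-1 * (y k ^+ deg t.+1 * (phi lambda * y k + phi (a t t.+1) * y t.+1)).
  have E : phi (a t t.+1)^-1 * phi (a t t.+1) = 1 by rewrite -rmorphM mulVf ?rmorph1.
  rewrite -[y t.+1 in LHS]mul1r -E rmorphN rmorphM /=; ring.
by apply/(gidealZ gI)/stepI; lia.
Qed.

Lemma band_mixed t : (k <= t < r)%N -> (forall j, (k <= j < t)%N -> a j j.+1 != 0) ->
  exists nu, I (deg t).+1 (y k ^+ deg t * (y t - phi nu * y k)).
Proof.
by move=> kt /(solution_exists kt)[mu [_ _ _ Imu]]; exists (mu t); apply: Imu; lia.
Qed.

(** Without a y_(t+1) term, [step] leaves lambda times the required power of y_k; lambda = 0 would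
    make mu a nonzero point excluded by nondegeneracy. *)
Lemma band_pure t : (k <= t < r)%N -> (forall j, (k <= j < t)%N -> a j j.+1 != 0) ->
    (if (t.+1 < r)%N then a t t.+1 else 0) = 0 ->
  I (deg t.+1).+1 (y k ^+ (deg t.+1).+1).
Proof.
move=> kt /(solution_exists kt)[mu sol] a0; have := step kt sol.
case: sol => muk mu0 bandmu _; rewrite a0 rmorph0 mul0r addr0.
set lambda := band idfun a k r mu t => stepI.
have lambda0 : lambda != 0.
  apply: contra_eq_neq muk => lambda0; rewrite (@nd mu) 1?eq_sym ?oner_eq0 //; last by lia.
  move=> j kj; have [jt|tj|->] := ltngtP j t; [right; apply: bandmu; lia | by left; apply: mu0 | by right].
have -> : y k ^+ (deg t.+1).+1 = phi lambda^-1 * (y k ^+ deg t.+1 * (phi lambda * y k)).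
  have E : phi lambda^-1 * phi lambda = 1 by rewrite -rmorphM mulVf ?rmorph1.
  rewrite exprSr -[LHS]mul1r -E; ring.
exact: (gidealZ gI).
Qed.

End Powers.
End Band.

Lemma form_nogen (F R : comNzRingType) (phi : {rmorphism F -> R}) G m p :
  (forall x, ~ G x) -> form phi G m p -> (0 < m)%N -> p = 0.
Proof.
move=> noG; elim=> {m p} [//|//|m p q _ IHp _ IHq m0|m x p /noG//].
by rewrite IHp // IHq // addr0.
Qed.

Lemma graded_poly_ideal (K : fieldType) (R : comNzRingType) (phi : {rmorphism K -> R})
    (ys : seq {poly R}) G I :
    graded_ideal phi G I ->
    (forall x m (p : {poly R}), x \in ys -> (forall i, I m p`_i) -> forall i, I m.+1 (x * p)`_i) ->
  graded_ideal (const_scalar phi) (fun x => x \in ys) (poly_ideal phi ys I).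
Proof.
move=> gI IM; split=> [m|m p q [u fu Ip] [v fv Iq]|m c p [u fu Ip]|m x p xys [u fu Ip]].
- exists 0; first exact: form_zero.
  by move=> i; rewrite mulr0 subrr coef0; apply: (gideal0 gI).
- exists (u + v); first exact: form_add.
  by move=> i; rewrite mulrDr opprD addrACA coefD; apply: (gidealD gI).
- exists (const_scalar phi c * u).
    have -> : const_scalar phi c = poly_scalar phi c%:P by rewrite /= map_polyC.
    exact: form_scale.
  by move=> i; rewrite mulrCA -mulrBr coefCM; apply: (gidealZ gI).
exists (x * u); first exact: form_gen.
by move=> i; rewrite mulrCA -mulrBr; apply: IM.
Qed.

Section Band.

Variables (K : fieldType).
Hypothesis charK : [pchar K] =i pred0.

Section Step.

Variables (R : comNzRingType) (phi : {rmorphism K -> R}).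
Variables (k r : nat) (d : nat -> nat) (a : nat -> nat -> K) (y : nat -> R).
Variable I : nat -> R -> Prop.
Local Notation deg t := (\sum_(k <= j < t) d j)%N.
Local Notation tot t := (\sum_(t <= j < r) d j)%N.

Hypothesis kr : (k < r)%N.
Hypothesis gI : graded_ideal phi (vars k r y) I.
Hypothesis nd : nondegenerate a k r.
Hypothesis I_band : forall j, (k <= j < r)%N -> I (d j).+1 (y j ^+ d j * band phi a k r y j).
Hypothesis d_gt0 : forall j, (k <= j < r)%N -> (0 < d j)%N.
(** The ring varies because the induction hypothesis is applied to the degeneration, inside R[X]. *)
Hypothesis tails : forall (R' : comNzRingType) (phi' : {rmorphism K -> R'}) y' t d' I',
  (k < t <= r)%N ->
  (forall j, (t < j < r)%N -> 0 < d' j)%N ->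
  graded_ideal phi' (vars t r y') I' ->
  (forall j, (t <= j < r)%N -> I' (d' j).+1 (y' j ^+ d' j * band phi' a t r y' j)) ->
  exists gamma,
    lefschetz phi' (vars t r y') I' (\sum_(t <= j < r) d' j) (lincomb phi' t r gamma y').

(* The degeneration: y_i is replaced by 'X y_i for i > k, so that modulo 'X only the
   initial forms with respect to y_k remain. *)
Let yh i : {poly R} := if i == k then (y k)%:P else 'X * (y i)%:P.
Let Jh := poly_ideal phi [seq yh i | i <- index_iota k r] I.
Let Gh := vars k r yh.

Let yhk : yh k = (y k)%:P. Proof. by rewrite /yh eqxx. Qed.
Let yhi i : (k < i)%N -> yh i = 'X * (y i)%:P.
Proof. by move=> ki; rewrite /yh gtn_eqF. Qed.

Let coefXnC n p m : I m p -> forall i, I m ('X^n * p%:P)`_i.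
Proof.
move=> Ip i; rewrite coefMC coefXn; case: eqP => _; rewrite ?mul1r // mul0r.
exact: (gideal0 gI).
Qed.

Let gJh : graded_ideal (const_scalar phi) Gh Jh.
Proof.
apply: (graded_poly_ideal gI) => x m p /varsP[i ki ->] Ip j.
have Gi : vars k r y (y i) by apply/varsP; exists i.
rewrite /yh; case: eqP => [<-|_]; first by rewrite coefCM; apply: (gidealM gI).
rewrite -mulrA coefXM; case: eqP => _; first exact: (gideal0 gI).
by rewrite coefCM; apply: (gidealM gI).
Qed.

Let fh i : (k <= i < r)%N -> form (poly_scalar phi) Gh 1 (yh i).
Proof. by move=> ki; apply: form_lin; apply/varsP; exists i. Qed.

Let Jh_band j : (k < j < r)%N ->
  Jh (d j).+1 (yh j ^+ d j * band (const_scalar phi) a k.+1 r yh j).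
Proof.
move=> kj; have jk : (k <= j < r)%N by lia.
(* In ['X]^(d_j+1) y_j^(d_j) l_j every term of l_j absorbs its ['X] into some yh_i except the y_k
   term, which keeps a spare factor ['X]. *)
exists (- (yh j ^+ d j * (poly_scalar phi (a j k)%:P * yh k))).
  rewrite -addn1; apply/form_opp/form_mul; first exact/form_pow/fh.
  by apply/form_scale/fh; lia.
have E : band (const_scalar phi) a k.+1 r yh j = 'X * (band phi a k.+1 r y j)%:P.
  rewrite /band rmorph_sum mulr_sumr big_seq_cond [RHS]big_seq_cond.
  apply: eq_bigr => i /andP[]; rewrite mem_index_iota => ki _.
  by rewrite yhi /= ?polyCM; [ring | lia].
have -> : yh j ^+ d j * band (const_scalar phi) a k.+1 r yh j -
    'X * - (yh j ^+ d j * (poly_scalar phi (a j k)%:P * yh k)) =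
    'X ^+ (d j).+1 * (y j ^+ d j * band phi a k r y j)%:P.
  rewrite E yhk yhi; last by lia.
  rewrite [band phi a k r y j]band_ltn //; last by lia.
  rewrite /= map_polyC exprMn exprS !polyCM polyCD polyCM rmorphXn /=; ring.
exact/coefXnC/I_band.
Qed.

Let Jh_mixed t : (k < t < r)%N -> (forall j, (k <= j < t)%N -> a j j.+1 != 0) ->
  Jh (deg t).+1 (yh k ^+ deg t * yh t).
Proof.
move=> kt a0; have [|nu Inu] := band_mixed gI nd I_band _ a0; first by lia.
(* Multiplied by ['X], the relation y_k^(deg t) (y_t - nu y_k) becomes y_k^(deg t) yh_t minus a
   multiple of ['X]. *)
exists (poly_scalar phi nu%:P * yh k ^+ (deg t).+1).
  by apply/form_scale/form_pow/fh; lia.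
move=> i; have -> : yh k ^+ deg t * yh t - 'X * (poly_scalar phi nu%:P * yh k ^+ (deg t).+1) =
    'X^1 * (y k ^+ deg t * (y t - phi nu * y k))%:P; last exact: coefXnC.
rewrite yhk yhi; last by lia.
rewrite expr1 /= map_polyC polyCM polyCB polyCM rmorphXn /= exprS; ring.
Qed.

Let Jh_pure t : (k <= t < r)%N -> (forall j, (k <= j < t)%N -> a j j.+1 != 0) ->
    (if (t.+1 < r)%N then a t t.+1 else 0) = 0 ->
  Jh (deg t.+1).+1 (yh k ^+ (deg t.+1).+1).
Proof.
move=> kt a0 at0; exists 0; first exact: form_zero.
move=> i; have -> : yh k ^+ (deg t.+1).+1 - 'X * 0 = 'X^0 * (y k ^+ (deg t.+1).+1)%:P.
  by rewrite mulr0 subr0 yhk expr0 mul1r rmorphXn.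
by apply: coefXnC; apply: (band_pure gI nd).
Qed.

Lemma lefschetz_step : exists gamma,
  lefschetz phi (vars k r y) I (tot k) (lincomb phi k r gamma y).
Proof.
(* The index r-1 always qualifies, since l_(r-1) has no further variable; s is the least such
   index. *)
pose last_ t := (k <= t < r)%N && ((if (t.+1 < r)%N then a t t.+1 else 0) == 0).
have ex_last : exists t, last_ t.
  by exists r.-1; rewrite /last_ prednK ?ltnn ?eqxx ?andbT; lia.
case: (ex_minnP ex_last) => s /andP[ks /eqP as0] s_min.
have a0 t j : (t <= s)%N -> (k <= j < t)%N -> a j j.+1 != 0.
  move=> ts kj; apply/eqP => aj0; suff /s_min : last_ j by lia.
  by rewrite /last_ aj0 if_same eqxx andbT; lia.
have [|||gamma lef] :=
  @lefschetz_degenerate K charK _ (const_scalar phi) k s r d a yh Jh ks d_gt0 gJh Jh_band.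
- by move=> t kt; apply: Jh_mixed; [lia | move=> j; apply: a0; lia].
- exact: Jh_pure (fun j => a0 s j (leqnn s)) as0.
- by move=> t d' I'; apply: tails.
have yh_eval i t : (k <= i < r)%N -> (yh i).[phi t] = if i == k then y i else phi t * y i.
  by rewrite /yh; case: eqP => [->|_]; rewrite ?hornerM ?hornerX hornerC.
have fyh t x : x \in [seq p.[phi t] | p <- [seq yh i | i <- index_iota k r]] ->
    form phi (vars k r y) 1 x.
  case/mapP => p /mapP[i]; rewrite mem_index_iota => ki -> ->; rewrite yh_eval //.
  by case: eqP => _; [|apply: form_scale]; apply: form_var.
have [||Phi Phi0 PhiP] := @lefschetz_specialize K R phi [seq yh i | i <- index_iota k r] I _ (tot k)
    (yh k + lincomb (const_scalar phi) k.+1 r gamma yh) _ lef.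
- by move=> t; apply: (graded_ideal_sub gI); apply: fyh.
- apply: form_add; first by apply: fh; lia.
  apply: form_const_poly; apply: form_sub (form_lincomb _ _ _ _ _) => x /varsP[i ki ->].
  by apply/varsP; exists i => //; lia.
(* The factor ['X] makes t nonzero, so that the y_i can be recovered from the rescaled t y_i. *)
have [t] := poly_nonroot charK (mulf_neq0 Phi0 (negbT (polyX_eq0 K))).
rewrite hornerM hornerX mulf_eq0 negb_or => /andP[/PhiP{}lef t0].
exists (fun i => if i == k then 1 else t * gamma i).
apply: lefschetz_reduce lef => //; last first.
- suff -> : lincomb phi k r (fun i => if i == k then 1 else t * gamma i) y =
     (yh k + lincomb (const_scalar phi) k.+1 r gamma yh).[phi t] by rewrite subrr; apply: (gideal0 gI).
  rewrite /lincomb big_ltn // eqxx rmorph1 mul1r hornerD yhk hornerC horner_sum; congr (_ + _).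
  apply: eq_big_nat => i ki; rewrite gtn_eqF; last by lia.
  by rewrite hornerM hornerC yh_eval ?gtn_eqF; [rewrite rmorphM; ring | lia | lia].
- rewrite hornerD yhk hornerC; apply: form_add; first by apply: form_var; lia.
  rewrite /lincomb horner_sum big_seq; apply: form_sum => i; rewrite mem_index_iota => ki.
  rewrite hornerM hornerC; apply: form_scale; apply: fyh; apply: map_f; apply: map_f.
  by rewrite mem_index_iota; lia.
- exact: form_lincomb.
- exact: fyh.
move=> x /varsP[i ki ->]; exists (y i); last by rewrite subrr; apply: (gideal0 gI).
have Gi : (yh i).[phi t] \in [seq p.[phi t] | p <- [seq yh i | i <- index_iota k r]].
  by apply: map_f; apply: map_f; rewrite mem_index_iota.
move: Gi; rewrite yh_eval //; case: eqP => _ Gi; first exact: form_lin.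
have -> : y i = phi t^-1 * (phi t * y i) by rewrite mulrA -rmorphM mulVf // rmorph1 mul1r.
exact/form_scale/form_lin.
Qed.

End Step.

(** Only membership of the relations in I is assumed, so the pieces of the filtration qualify. N
    bounds the number of variables. *)
Theorem lefschetz_band N k r d a (R : comNzRingType) (phi : {rmorphism K -> R}) y I :
    (k <= r)%N -> (r - k <= N)%N -> nondegenerate a k r ->
    (forall j, (k < j < r)%N -> 0 < d j)%N -> graded_ideal phi (vars k r y) I ->
    (forall j, (k <= j < r)%N -> I (d j).+1 (y j ^+ d j * band phi a k r y j)) ->
  exists gamma, lefschetz phi (vars k r y) I (\sum_(k <= j < r) d j) (lincomb phi k r gamma y).
Proof.
elim: N k d a R phi y I => [|N IH] k d a R phi y I kr Nr nd d_gt0 gI I_band.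
  have -> : r = k by lia.
  exists (fun=> 0) => m _ p fp; rewrite /lincomb !big_geq //.
  have noG x : ~ vars k k y x by case/varsP=> i; lia.
  case: m => [|m] in fp *.
    by exists p; rewrite expr0 mul1r subrr; split=> //; apply: (gideal0 gI).
  exists 0; rewrite (form_nogen noG fp) // mulr0 subrr; split; first exact: formz_zero.
  exact: (gideal0 gI).
have [rk|{}kr] := leqP r k; first by apply: (IH k d a R phi y I) => //; lia.
(* If d k = 0, the relation is l_k itself, a combination of y_k and y_(k+1) that eliminates y_k;
   otherwise the degeneration applies. *)
have [dk|dk] := posnP (d k); last first.
  apply: (lefschetz_step kr gI nd I_band) => [j kj|R' phi' y' t d' I' kt d'0 gI' I'_band].
    by have [->|] := eqVneq j k => // ne_jk; apply: d_gt0; lia.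
  apply: (IH t d' a R' phi' y' I') => //; [lia | lia | ] => v vP j tj.
  pose w i := if (i < t)%N then 0 else v i.
  have wE i : (t <= i)%N -> w i = v i by move=> ti; rewrite /w ltnNge ti.
  rewrite -(wE j) ?(nd w) //; [move=> i ki | lia | lia].
  have [it|ti] := ltnP i t; first by left; rewrite /w it.
  have [|<-|<-] := vP i; [lia | left; exact: wE | right].
  rewrite /band (big_cat_nat (n := t)) //=; [|lia|lia].
  rewrite big_seq_cond big1 ?add0r => [|u]; last first.
    by rewrite mem_index_iota => /andP[/andP[_ ut] _]; rewrite /w ut mulr0.
  rewrite big_seq_cond [RHS]big_seq_cond; apply: eq_bigr => u.
  by rewrite mem_index_iota => /andP[/andP[tu _] _]; rewrite wE.
pose b := if (k.+1 < r)%N then a k k.+1 else 0.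
have bandk (R0 : comNzRingType) (psi : {rmorphism K -> R0}) v :
    band psi a k r v k = psi (a k k) * v k + psi b * v k.+1.
  by rewrite band_ltn // band_diag.
have akk : a k k != 0.
  apply/eqP => akk; suff /eqP : (k == k)%:R = 0 :> K by rewrite eqxx oner_eq0.
  apply: (nd (fun i => (i == k)%:R)) => [j kj|]; last by lia.
  have [->|] := eqVneq j k; last by left.
  by right; rewrite bandk /= akk mul0r add0r gtn_eqF // mulr0.
pose beta := b / a k k.
(* Coefficients after substituting y_k = - beta y_(k+1). Only column k+1 changes, which every later
   row may use, so the band shape survives. *)
pose a' j i := if i == k.+1 then a j i - beta * a j k else a j i.
have a'E (R0 : comNzRingType) (psi : {rmorphism K -> R0}) v j : (k < j < r)%N ->
    band psi a' k.+1 r v j = band psi a k r v j - psi (a j k) * (v k + psi beta * v k.+1).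
  move=> kj; rewrite [LHS]band_ltn; [|lia|lia].
  rewrite [band psi a k r v j]band_ltn; [|lia|lia].
  rewrite [band psi a k.+1 r v j]band_ltn; [|lia|lia].
  have -> : band psi a' k.+2 r v j = band psi a k.+2 r v j.
    rewrite /band big_seq_cond [RHS]big_seq_cond; apply: eq_bigr => i.
    by rewrite mem_index_iota /a' => ki; rewrite gtn_eqF //; lia.
  by rewrite /a' eqxx rmorphB rmorphM; ring.
have I1 : I 1%N (y k + phi beta * y k.+1).
  have := I_band k; rewrite leqnn kr dk expr0 mul1r bandk => /(_ isT).
  move=> /(gidealZ gI (a k k)^-1); rewrite mulrDr !mulrA -!rmorphM mulVf // rmorph1 mul1r.
  by rewrite /beta [b / _]mulrC.
have Gy i : (k <= i < r)%N -> form phi (vars k r y) 1 (y i) by apply: form_var.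
have subG x : vars k.+1 r y x -> vars k r y x.
  by case/varsP=> i ki ->; apply/varsP; exists i => //; lia.
have [|||||j kj|gamma lef] := IH k.+1 d a' R phi y I.
- by [].
- by lia.
- move=> v vP j kj.
  pose w i := if i == k then - (beta * v k.+1) else v i.
  have wE i : (k < i)%N -> w i = v i by move=> ki; rewrite /w gtn_eqF.
  rewrite -(wE j) ?(nd w) //; [move=> i ki | lia | lia].
  have wk : w k + beta * w k.+1 = 0 by rewrite /w eqxx gtn_eqF // addNr.
  have [->|ne_ik] := eqVneq i k.
    by right; rewrite bandk /= -[b](divfK akk) -/beta -[RHS](mulr0 (a k k)) -wk; ring.
  have ki' : (k < i < r)%N by lia.
  have [v0|bv] := vP i ki'; [by left; rewrite wE //; lia | right].
  have := a'E _ idfun w i ki'; rewrite /= wk mulr0 subr0 => <-; rewrite -bv.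
  rewrite /band big_seq_cond [RHS]big_seq_cond; apply: eq_bigr => u.
  by rewrite mem_index_iota => /andP[/andP[ku _] _]; rewrite wE.
- by move=> j kj; apply: d_gt0; lia.
- apply: (graded_ideal_sub gI) => x /subG Gx; exact: form_lin.
- rewrite a'E //.
  rewrite mulrBr; apply: (gideal_sub gI); first by apply: I_band; lia.
  rewrite mulrCA -addn1; apply/(gidealZ gI)/(gideal_mul gI) => //.
  by apply/form_pow/Gy; lia.
exists (fun i => if i == k then 0 else gamma i).
have -> : (\sum_(k <= j < r) d j = \sum_(k.+1 <= j < r) d j)%N by rewrite big_ltn // dk.
apply: lefschetz_reduce lef => //.
- move=> x /varsP[i ki ->]; have [->|ne_ik] := eqVneq i k; last first.
    exists (y i); last by rewrite subrr; apply: (gideal0 gI).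
    by apply/form_lin/varsP; exists i => //; lia.
  exists (- (phi beta * y k.+1)); last by rewrite opprK.
  apply: form_opp; have [kr'|rk'] := ltnP k.+1 r.
    by apply/form_scale/form_lin/varsP; exists k.+1 => //; lia.
  by rewrite /beta /b ltnNge rk' /= mul0r rmorph0 mul0r; apply: form_zero.
- by move=> x /subG Gx; apply: form_lin.
- exact: form_lincomb.
- by apply: form_sub (form_lincomb _ _ _ _ _).
suff -> : lincomb phi k r (fun i => if i == k then 0 else gamma i) y = lincomb phi k.+1 r gamma y.
  by rewrite subrr; apply: (gideal0 gI).
rewrite /lincomb big_ltn // eqxx rmorph0 mul0r add0r; apply: eq_big_nat => i ki.
by rewrite gtn_eqF //; lia.
Qed.

End Band.

(** * Regularity and the socle *)

Section Ideals.

Variables (R : comNzRingType) (n : nat).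
Implicit Types (f g : 'I_n -> R) (T : {set 'I_n}) (p q : R).

Definition ideal_on T f p := exists h : 'I_n -> R, p = \sum_(i in T) h i * f i.

Lemma ideal_on0 T f : ideal_on T f 0.
Proof. by exists (fun=> 0); rewrite big1 // => i _; rewrite mul0r. Qed.

Lemma ideal_onD T f p q : ideal_on T f p -> ideal_on T f q -> ideal_on T f (p + q).
Proof.
move=> [h ->] [h' ->]; exists (fun i => h i + h' i); rewrite -big_split.
by apply: eq_bigr => i _; rewrite mulrDl.
Qed.

Lemma ideal_onM T f p q : ideal_on T f q -> ideal_on T f (p * q).
Proof.
move=> [h ->]; exists (fun i => p * h i); rewrite mulr_sumr.
by apply: eq_bigr => i _; rewrite mulrA.
Qed.

Lemma ideal_onB T f p q : ideal_on T f p -> ideal_on T f q -> ideal_on T f (p - q).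
Proof. by move=> Ip /(ideal_onM (-1)); rewrite mulN1r; apply: ideal_onD. Qed.

Lemma ideal_on_gen T f i : i \in T -> ideal_on T f (f i).
Proof.
move=> iT; exists (fun j => (j == i)%:R); rewrite (bigD1 i) //= eqxx mul1r big1 ?addr0 //.
by move=> j /andP[_ /negPf->]; rewrite mul0r.
Qed.

Lemma eq_ideal_on T f g p : {in T, f =1 g} -> ideal_on T f p -> ideal_on T g p.
Proof. by move=> fg [h ->]; exists h; apply: eq_bigr => i iT; rewrite fg. Qed.

Lemma ideal_on_sub T T' f p : T \subset T' -> ideal_on T f p -> ideal_on T' f p.
Proof.
move=> /subsetP sT [h ->]; elim/big_ind: _ => [|x y|i /sT iT'].
- exact: ideal_on0.
- exact: ideal_onD.
- exact/ideal_onM/ideal_on_gen.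
Qed.

Lemma ideal_on_split T f i p : i \in T ->
  ideal_on T f p <-> exists u, ideal_on (T :\ i) f (p - u * f i).
Proof.
move=> iT; split=> [[h ->]|[u Iu]].
  by exists (h i); exists h; rewrite (big_setD1 i) //= addrAC subrr add0r.
rewrite -[p](subrK (u * f i)); apply: ideal_onD; last exact/ideal_onM/ideal_on_gen.
exact: ideal_on_sub (subD1set _ _) Iu.
Qed.

(* Every f_i is a nonzerodivisor modulo the others, for any set of others;
   this is regularity in a form that is symmetric in f. *)
Definition regular f := forall T i p, i \notin T ->
  ideal_on T f (f i * p) -> ideal_on T f p.

Section Product.

Variables (f g h : 'I_n -> R) (i : 'I_n).
Hypothesis fgh : forall j, j != i -> g j = f j /\ h j = f j.
Hypothesis fi : f i = g i * h i.

Lemma ideal_on_left T p : i \notin T -> ideal_on T f p <-> ideal_on T g p.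
Proof.
move=> iT; split; apply: eq_ideal_on => j jT; case: (fgh (j := j)) => //.
  by apply: contraNneq iT => <-.
by apply: contraNneq iT => <-.
Qed.

Lemma ideal_on_right T p : i \notin T -> ideal_on T f p <-> ideal_on T h p.
Proof.
move=> iT; split; apply: eq_ideal_on => j jT; case: (fgh (j := j)) => //.
  by apply: contraNneq iT => <-.
by apply: contraNneq iT => <-.
Qed.

Lemma ideal_on_left_split T p : i \in T ->
  ideal_on T g p <-> exists u, ideal_on (T :\ i) f (p - u * g i).
Proof.
move=> iT; rewrite (ideal_on_split _ _ iT).
by split=> -[u Iu]; exists u; apply/ideal_on_left; rewrite ?setD11.
Qed.

Lemma ideal_on_right_split T p : i \in T ->
  ideal_on T h p <-> exists u, ideal_on (T :\ i) f (p - u * h i).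
Proof.
move=> iT; rewrite (ideal_on_split _ _ iT).
by split=> -[u Iu]; exists u; apply/ideal_on_right; rewrite ?setD11.
Qed.

Lemma ideal_on_product T p u : i \in T ->
  ideal_on (T :\ i) f (p - u * g i) -> ideal_on T h u -> ideal_on T f p.
Proof.
move=> iT Ip /(ideal_on_right_split _ iT)[w Iw].
apply/(ideal_on_split _ _ iT); exists w.
have -> : p - w * f i = (p - u * g i) + g i * (u - w * h i) by rewrite fi; ring.
by apply: ideal_onD => //; apply: ideal_onM.
Qed.

Hypotheses (rg : regular g) (rh : regular h).

Lemma regular_left T p : i \notin T -> ideal_on T f (g i * p) -> ideal_on T f p.
Proof. by move=> iT /(ideal_on_left _ iT)/(rg iT)/(ideal_on_left _ iT). Qed.

Lemma regular_right T p : i \notin T -> ideal_on T f (h i * p) -> ideal_on T f p.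
Proof. by move=> iT /(ideal_on_right _ iT)/(rh iT)/(ideal_on_right _ iT). Qed.

(** For i in T, regularity of g gives p = v g_i modulo the other generators. Cancelling g_i puts f_j
    v in the ideal of h, hence v too, and p = v g_i falls into the ideal of f. *)
Lemma regular_mul : regular f.
Proof.
move=> T j p jT; have [eji|ne_ji] := eqVneq j i.
  by rewrite eji in jT *; rewrite fi -mulrA => /(regular_left jT)/(regular_right jT).
have [gj hj] := fgh ne_ji.
have [iT|iT] := boolP (i \in T); last first.
  by move/(ideal_on_left _ iT); rewrite -gj => /(rg jT)/(ideal_on_left _ iT).
have iT' : i \notin T :\ i by rewrite setD11.
move=> /(ideal_on_split _ _ iT)[u]; rewrite fi => Iu.
have /(ideal_on_left_split _ iT)[v Iv] : ideal_on T g p.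
  apply: (rg jT); apply/(ideal_on_left_split _ iT); exists (u * h i).
  by rewrite gj -mulrA [h i * _]mulrC.
apply: (ideal_on_product iT Iv).
apply: (rh jT); apply/(ideal_on_right_split _ iT); exists u.
rewrite hj; apply: (regular_left iT').
have -> : g i * (f j * v - u * h i) =
    (f j * p - u * (g i * h i)) - f j * (p - v * g i) by ring.
by apply: ideal_onB => //; apply: ideal_onM.
Qed.

End Product.

End Ideals.

Section Polynomials.

Variables (K : fieldType) (n : nat).
Local Notation R := {mpoly K[n]}.
Local Notation phi := (@mpolyC n K : {rmorphism K -> R}).
Implicit Types (p q : R).

Definition mvar (i : nat) : R := oapp (fun j : 'I_n => 'X_j) 0 (insub i).
Local Notation form := (form phi (vars 0 n mvar)).
Local Notation formz := (formz phi (vars 0 n mvar)).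

Lemma mvarE (i : 'I_n) : mvar i = 'X_i.
Proof. by rewrite /mvar valK. Qed.

Lemma form_X i : form 1 ('X_i : R).
Proof. by apply: form_lin; apply/varsP; exists (val i); rewrite ?mvarE //= ltn_ord. Qed.

Lemma form_Xm (e : 'X_{1..n}) : form (mdeg e) ('X_[e] : R).
Proof.
rewrite mpolyXE_id mdegE; elim/big_ind2: _ => [|m p k q|i _].
- exact: form_one.
- exact: form_mul.
- by rewrite -{1}[e i]mul1n; apply/form_exp/form_X.
Qed.

Lemma form_ind_mpoly (P : nat -> R -> Prop) :
  (forall c, P 0%N c%:MP) -> (forall m, P m 0) -> (forall m p q, P m p -> P m q -> P m (p + q)) ->
  (forall m i p, form m p -> P m p -> P m.+1 ('X_i * p)) -> forall m p, form m p -> P m p.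
Proof.
move=> PC P0 PD PX m p; elim=> {m p} [c|m|m p q _ Pp _ Pq|m x p Gx fp Pp].
- exact: PC.
- exact: P0.
- exact: PD.
by case/varsP: Gx => i ltin ->; rewrite -[i]/(val (Ordinal (ltin : (i < n)%N))) mvarE; apply: PX.
Qed.

Lemma pihomog_form m p : form m (pihomog mdeg m p).
Proof.
rewrite pihomogE; apply: form_sum => e /eqP <-.
by rewrite -mul_mpolyC; apply/form_scale/form_Xm.
Qed.

Lemma pihomogC m c p : pihomog mdeg m (c%:MP * p) = c%:MP * pihomog mdeg m p.
Proof. by rewrite !mul_mpolyC linearZ. Qed.

Lemma pihomogX_mul m i p :
  pihomog mdeg m ('X_i * p) = if m is m'.+1 then 'X_i * pihomog mdeg m' p else 0.
Proof.
rewrite [p in LHS]mpolyE mulr_sumr linear_sum.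
rewrite (eq_bigr (fun e => p@_e *: (if m is m'.+1 then 'X_i * pihomog mdeg m' 'X_[e] else 0))); last first.
  move=> e _; rewrite -scalerAr linearZ /= -mpolyXD pihomogX /= mdegD mdeg1 add1n.
  case: m => [|m] //; rewrite pihomogX eqSS; case: eqP => _; rewrite ?mulr0 //.
  by rewrite mpolyXD.
case: m => [|m]; first by rewrite big1 // => e _; rewrite scaler0.
rewrite [p in RHS]mpolyE linear_sum mulr_sumr; apply: eq_bigr => e _.
by rewrite linearZ scalerAr.
Qed.

Lemma pihomog_mul_form m k f p : form k f ->
  pihomog mdeg m (f * p) = if (k <= m)%N then f * pihomog mdeg (m - k) p else 0.
Proof.
move=> ff; elim/form_ind_mpoly: ff m p => {k f} [c|k|k f g Hf Hg|k i f _ Hf] m p.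
- by rewrite pihomogC leq0n subn0.
- by rewrite !mul0r linear0 if_same.
- by rewrite !mulrDl linearD /= Hf Hg; case: ifP => _ //; rewrite addr0.
rewrite -mulrA pihomogX_mul; case: m => [|m] //; rewrite Hf ltnS subSS.
by case: ifP => _; rewrite ?mulr0 ?mulrA.
Qed.

Lemma pihomog_id_form m p : form m p -> pihomog mdeg m p = p.
Proof.
move/pihomog_mul_form => /(_ m 1); rewrite leqnn subnn mulr1 => ->.
by rewrite -mpolyX0 pihomogX /= mdeg0 eqxx mpolyX0 mulr1.
Qed.

(** The degree m component of the identity fixes p and replaces each coefficient by its component of
    complementary degree. *)
Lemma ideal_on_form (T : {set 'I_n}) (f : 'I_n -> R) (deg : 'I_n -> nat) m p :
    (forall i, i \in T -> form (deg i) (f i)) -> form m p -> ideal_on T f p ->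
  exists2 h : 'I_n -> R, forall i, formz m (deg i) (h i) & p = \sum_(i in T) h i * f i.
Proof.
move=> ff fp [h Ep]; exists (fun i => if (deg i <= m)%N then pihomog mdeg (m - deg i) (h i) else 0).
  by move=> i; rewrite /formz; case: leqP => // _; apply: pihomog_form.
rewrite -{1}(pihomog_id_form fp) Ep linear_sum; apply: eq_bigr => i iT /=.
by rewrite mulrC (pihomog_mul_form _ _ (ff i iT)); case: ifP => _; rewrite ?mul0r // mulrC.
Qed.

Implicit Types (d : 'I_n -> nat) (a : 'I_n -> 'I_n -> K).

Definition linform a i : R := \sum_j (a i j)%:MP * 'X_j.
Definition power_form d a i : R := 'X_i ^+ d i * linform a i.
(* Equivalently, all the principal minors of a are nonzero. *)
Definition principal a := forall v : 'I_n -> K,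
  (forall i, v i = 0 \/ \sum_j a i j * v j = 0) -> forall i, v i = 0.

Lemma form_linform a i : form 1 (linform a i).
Proof. by apply: form_sum => j _; apply/form_scale/form_X. Qed.

Lemma form_power_form d a i : form (d i).+1 (power_form d a i).
Proof. by rewrite -addn1; apply: form_mul (form_linform _ _); apply/form_pow/form_X. Qed.

Section Independent.

Variable a : 'I_n -> 'I_n -> K.
Hypothesis pa : principal a.

Let A := \matrix_(i, j) a i j.
Let B := invmx A.

Let unitA : A \in unitmx.
Proof.
rewrite -unitmx_tr -row_free_unit; apply: inj_row_free => v vA.
apply/rowP => i; rewrite mxE; apply: (pa (v := v 0)) => k; right.
have := congr1 (fun w : 'rV_n => w 0 k) vA; rewrite !mxE; apply: etrans.
by apply: eq_bigr => j _; rewrite !mxE mulrC.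
Qed.

Let AB i j : \sum_k a i k * B k j = (i == j)%:R.
Proof.
have := congr1 (fun M : 'M_n => M i j) (mulmxV unitA); rewrite !mxE => <-.
by apply: eq_bigr => k _; rewrite mxE.
Qed.

Let BA i j : \sum_k B i k * a k j = (i == j)%:R.
Proof.
have := congr1 (fun M : 'M_n => M i j) (mulVmx unitA); rewrite !mxE => <-.
by apply: eq_bigr => k _; rewrite !mxE.
Qed.

Let X_linform k : 'X_k = \sum_j (B k j)%:MP * linform a j.
Proof.
under eq_bigr => j _ do rewrite mulr_sumr.
rewrite exchange_big (bigD1 k) //= [X in _ = _ + X]big1 ?addr0 => [|i ne_ik].
  under eq_bigr => j _ do rewrite mulrA -mpolyCM.
  by rewrite -mulr_suml -raddf_sum /= BA eqxx mpolyC1 mul1r.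
under eq_bigr => j _ do rewrite mulrA -mpolyCM.
by rewrite -mulr_suml -raddf_sum /= BA eq_sym (negPf ne_ik) mpolyC0 mul0r.
Qed.

Lemma linform_neq0 i : linform a i != 0.
Proof.
apply/eqP => li0; have /eqP := AB i i; rewrite eqxx big1 ?(eq_sym 0) ?oner_eq0 // => k _.
have : (linform a i)@_U_(k) = a i k.
  rewrite /linform raddf_sum (bigD1 k) //= mcoeffCM mcoeffXU eqxx mulr1 big1 ?addr0 // => j ne_jk.
  by rewrite mcoeffCM mcoeffXU (negPf ne_jk) mulr0.
by rewrite li0 mcoeff0 => <-; rewrite mul0r.
Qed.

(* The substitution killing the l_j with j in T and fixing the others: its kernel is
   the ideal generated by these l_j, which is therefore prime. *)
Let kill (T : {set 'I_n}) := [tuple \sum_(j | j \notin T) (B k j)%:MP * linform a j | k < n].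

Let kill_linform T i : linform a i \mPo kill T = if i \in T then 0 else linform a i.
Proof.
rewrite {1}/linform raddf_sum /=.
under eq_bigr => k _ do rewrite rmorphM /= comp_mpolyC comp_mpolyXU -tnth_nth tnth_mktuple mulr_sumr.
rewrite exchange_big /=.
under eq_bigr => j _ do [under eq_bigr => k _ do rewrite mulrA -mpolyCM;
  rewrite -mulr_suml -raddf_sum /= AB].
have [iT|iT] := ifPn.
  rewrite big1 // => j jT; have /negPf-> : i != j by apply: contraNneq jT => <-.
  by rewrite mpolyC0 mul0r.
rewrite (bigD1 i) //= eqxx mpolyC1 mul1r big1 ?addr0 // => j /andP[_ ne_ji].
by rewrite eq_sym (negPf ne_ji) mpolyC0 mul0r.
Qed.

Let sub_kill T p : ideal_on T (linform a) (p - (p \mPo kill T)).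
Proof.
have mul u v : ideal_on T (linform a) (u - (u \mPo kill T)) ->
    ideal_on T (linform a) (v - (v \mPo kill T)) ->
    ideal_on T (linform a) (u * v - (u * v \mPo kill T)).
  move=> Iu Iv; rewrite rmorphM /=.
  have -> : u * v - (u \mPo kill T) * (v \mPo kill T) =
     u * (v - (v \mPo kill T)) + (v \mPo kill T) * (u - (u \mPo kill T)) by ring.
  by apply: ideal_onD; apply: ideal_onM.
have IX k : ideal_on T (linform a) ('X_k - ('X_k \mPo kill T)).
  rewrite comp_mpolyXU -tnth_nth tnth_mktuple X_linform (bigID (mem T)) /= addrK.
  by exists (fun j => (B k j)%:MP).
elim/mpolyind: p => [|c m p _ _ Ip]; first by rewrite comp_mpoly0 subrr; apply: ideal_on0.
rewrite raddfD /= opprD addrACA; apply: ideal_onD => //.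
rewrite comp_mpolyZ -scalerBr -mul_mpolyC; apply: ideal_onM.
rewrite mpolyXE_id; elim/big_ind: _ => //; first by rewrite comp_mpoly1 subrr; apply: ideal_on0.
move=> i _; elim: (m i) => [|e IH]; first by rewrite expr0 comp_mpoly1 subrr; apply: ideal_on0.
by rewrite exprS; apply: mul.
Qed.

Lemma regular_linform : regular (linform a).
Proof.
move=> T i p iT [h Eh]; have := congr1 (comp_mpoly (kill T)) Eh.
rewrite rmorphM /= kill_linform (negPf iT) raddf_sum big1 => [|j jT]; last first.
  by rewrite /= rmorphM /= kill_linform jT mulr0.
move/eqP; rewrite mulf_eq0 (negPf (linform_neq0 i)) /= => /eqP p0.
by have := sub_kill T p; rewrite p0 subr0.
Qed.

Lemma ideal_linform m p : (0 < m)%N -> form m p -> ideal_on setT (linform a) p.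
Proof.
move=> m0 fp; elim/form_ind_mpoly: fp m0 => {m p} [//|m _|m p q Ip Iq m0|m i p _ _ _].
- exact: ideal_on0.
- by apply: ideal_onD; [apply: Ip | apply: Iq].
rewrite mulrC; apply: ideal_onM; rewrite X_linform; exists (fun j => (B i j)%:MP).
by apply: eq_bigl => j; rewrite inE.
Qed.

End Independent.

Definition vanishes_above (f : 'I_n -> R) c := forall m p,
  (c < m)%N -> form m p -> ideal_on setT f p.
(** Nondegeneracy of the pairing of A_m with A_(c-m) into A_c. *)
Definition socle_in (f : 'I_n -> R) c := forall m p, (m <= c)%N -> form m p ->
  (forall q, form (c - m) q -> ideal_on setT f (p * q)) -> ideal_on setT f p.

Section ProductStep.

Variables (f g h : 'I_n -> R) (i : 'I_n) (deg : 'I_n -> nat) (e cg ch : nat).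
Hypothesis fgh : forall j, j != i -> g j = f j /\ h j = f j.
Hypothesis fi : f i = g i * h i.
Hypothesis g_lin : form 1 (g i).
Hypothesis h_deg : form e (h i).
Hypothesis f_deg : forall j, j != i -> form (deg j) (f j).
Hypothesis cgh : (cg + e = ch.+1)%N.
Hypotheses (vg : vanishes_above g cg) (vh : vanishes_above h ch).

Let iT : i \in [set: 'I_n]. Proof. exact: in_setT. Qed.

Let lift_left m p : form m p -> ideal_on setT g p ->
  exists2 u, formz m 1 u & ideal_on (setT :\ i) f (p - u * g i).
Proof.
move=> fp Ip; have gdeg j : j \in [set: 'I_n] -> form (if j == i then 1%N else deg j) (g j).
  by case: eqP => [->|/eqP ne_ji] _; [|rewrite (proj1 (fgh ne_ji)); apply: f_deg].
have [u fu ->] := ideal_on_form gdeg fp Ip.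
exists (u i); first by have := fu i; rewrite eqxx.
rewrite (bigD1 i) //= addrAC subrr add0r; exists u.
by apply: eq_big => j; rewrite !inE ?andbT // => /fgh[->].
Qed.

Lemma vanishes_above_mul : vanishes_above f ch.+1.
Proof.
move=> m p m_gt fp; have [|u fu Iu] := lift_left fp; first by apply: vg fp; lia.
apply: (ideal_on_product fgh fi iT Iu); move: fu; rewrite /formz ifT; last by lia.
by apply: vh; lia.
Qed.

Hypotheses (rg : regular g) (rh : regular h).
Hypotheses (sg : socle_in g cg) (sh : socle_in h ch).

(** Testing p on multiples q h_i and cancelling h_i puts p in the ideal of g. Then p = u g_i modulo
    the rest, and cancelling g_i reduces the claim to u in the ideal of h. *)
Lemma socle_in_mul : socle_in f ch.+1.
Proof.
move=> m p le_m fp Ipq.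
have iT' : i \notin setT :\ i by rewrite setD11.
have Ig : ideal_on setT g p.
  have [le_mg|lt_gm] := leqP m cg; last exact: vg fp.
  apply: sg fp _ => // q fq; have : ideal_on setT f (p * (q * h i)).
    apply: Ipq; have -> : (ch.+1 - m = cg - m + e)%N by lia.
    exact: form_mul.
  move/(ideal_on_split _ _ iT)=> [u Iu]; apply/(ideal_on_left_split fgh _ iT); exists u.
  apply: (regular_right fgh rh iT'); have -> : h i * (p * q - u * g i) = p * (q * h i) - u * f i.
    by rewrite fi; ring.
  exact: Iu.
have [u fu Iu] := lift_left fp Ig; apply: (ideal_on_product fgh fi iT Iu).
move: fu; rewrite /formz; case: m => [|m] in fp le_m Ipq * => fu.
  by rewrite fu; apply: ideal_on0.
apply: sh fu _ => [|q fq]; first by lia.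
have : ideal_on setT f (p * q) by apply: Ipq; have -> : (ch.+1 - m.+1 = ch - (m.+1 - 1))%N by lia.
move/(ideal_on_split _ _ iT)=> [w Iw]; apply/(ideal_on_right_split fgh _ iT); exists w.
apply: (regular_left fgh rg iT').
have -> : g i * (u * q - w * h i) = (p * q - w * f i) - q * (p - u * g i) by rewrite fi; ring.
by apply: ideal_onB => //; apply: ideal_onM.
Qed.

End ProductStep.

Lemma power_form_regular d a : principal a ->
  [/\ regular (power_form d a), vanishes_above (power_form d a) (\sum_i d i)
    & socle_in (power_form d a) (\sum_i d i)].
Proof.
have [N] := ubnP (\sum_i d i); elim: N d a => // N IH d a ltN pa.
have [/existsP[i di]|/existsPn d0] := boolP [exists i, (0 < d i)%N]; last first.
  have {}d0 i : d i = 0%N by have := d0 i; rewrite -eqn0Ngt => /eqP.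
  have E : power_form d a =1 linform a by move=> i; rewrite /power_form d0 mul1r.
  have toE p : ideal_on setT (linform a) p -> ideal_on setT (power_form d a) p.
    by apply: eq_ideal_on => i _; rewrite E.
  rewrite big1 //; split.
  - move=> T i p iT; rewrite E => Ip; apply: (eq_ideal_on (f := linform a)) => [j _|]; first by rewrite E.
    by apply: (regular_linform pa iT); apply: eq_ideal_on Ip => j _; rewrite E.
  - by move=> m p m0 fp; apply/toE/(ideal_linform pa m0).
  - by move=> m p _ _ /(_ 1 (form_one _ _)); rewrite mulr1.
(* The split-off factor x_i is again a [power_form]: exponent 0 and unit row i. Its matrix stays
   principal because x_i was already one of the two choices at i. *)
pose dx j := if j == i then 0%N else d j; pose ax j k := if j == i then (k == i)%:R else a j k.
pose dg j := if j == i then (d i).-1 else d j.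
have dE : (\sum_j d j = d i + \sum_j dx j)%N.
  rewrite (bigD1 i) // [in RHS](bigD1 i) //= /dx eqxx; congr addn.
  by apply: eq_bigr => j /negPf->.
have gE : (\sum_j d j = (\sum_j dg j).+1)%N.
  rewrite (bigD1 i) // [in RHS](bigD1 i) //= /dg eqxx -addSn prednK //; congr addn.
  by apply: eq_bigr => j /negPf->.
have [||rx vx sx] := IH dx ax; first by lia.
  move=> v vP; apply: pa => j; case: (vP j); [by left | rewrite /ax; case: eqP => [->|_]]; last by right.
  rewrite (bigD1 i) //= eqxx mul1r big1 ?addr0 => [|k /negPf->]; first by left.
  by rewrite mul0r.
have [||rg vg sg] := IH dg a; [by lia | exact: pa |].
have agree j : j != i ->
    power_form dx ax j = power_form d a j /\ power_form dg a j = power_form d a j.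
  by move=> /negPf ne; rewrite /power_form /linform /dx /ax /dg !ne.
have xi : power_form dx ax i = 'X_i.
  rewrite /power_form /linform /dx /ax eqxx mul1r (bigD1 i) //= eqxx mul1r big1 ?addr0 // => k /negPf->.
  by rewrite mul0r.
have fi : power_form d a i = power_form dx ax i * power_form dg a i.
  by rewrite xi /power_form /dg eqxx mulrA -exprS prednK.
have flin : form 1 (power_form dx ax i) by rewrite xi; apply: form_X.
have fdeg := form_power_form d a.
have cE : (\sum_j dx j + (dg i).+1 = (\sum_j dg j).+1)%N.
  by rewrite /dg eqxx prednK // addnC -dE.
rewrite gE; split.
- exact: regular_mul agree fi rx rg.
- exact: (vanishes_above_mul agree fi flin (fun j _ => fdeg j) cE vx vg).
- exact: (socle_in_mul agree fi flin (form_power_form dg a i) (fun j _ => fdeg j) cE vx rx rg sx sg).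
Qed.

End Polynomials.

(** * Back to formal sums of terms *)

Section Bridge.

Variables (K : fieldType) (n : nat).
Local Notation R := {mpoly K[n]}.
Local Notation phi := (@mpolyC n K : {rmorphism K -> R}).
Local Notation form := (form phi (vars 0 n (@mvar K n))).
Implicit Types (p q : Defs.mpoly K n).

Definition mnm_of (e : mono n) : 'X_{1..n} := [multinom e i | i < n].
Definition mono_of (m : 'X_{1..n}) : mono n := [ffun i => m i].

Lemma mono_ofK : cancel mono_of mnm_of.
Proof. by move=> m; apply/mnmP => i; rewrite mnmE ffunE. Qed.

Lemma mnm_ofK : cancel mnm_of mono_of.
Proof. by move=> e; apply/ffunP => i; rewrite ffunE mnmE. Qed.

Definition sem p : R := \sum_(t <- p) t.1 *: 'X_[mnm_of t.2].

Lemma coeff_sem p e : (sem p)@_(mnm_of e) = mcoef p e.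
Proof.
rewrite /sem /mcoef raddf_sum [RHS]big_mkcond; apply: eq_bigr => t _.
rewrite /= mcoeffZ mcoeffX (can_eq mnm_ofK).
by case: eqP => _; rewrite ?mulr1 ?mulr0.
Qed.

Lemma semP p q : meq p q <-> sem p = sem q.
Proof.
split=> [pq|pq e]; last by rewrite -!coeff_sem pq.
by apply/mpolyP => m; rewrite -[m]mono_ofK !coeff_sem.
Qed.

Lemma sem_add p q : sem (madd p q) = sem p + sem q.
Proof. exact: big_cat. Qed.

Lemma sem_scale c p : sem (mscale c p) = c *: sem p.
Proof.
by rewrite /sem big_map scaler_sumr; apply: eq_bigr => t _; rewrite scalerA.
Qed.

Lemma sem_sub p q : sem (msub p q) = sem p - sem q.
Proof. by rewrite sem_add sem_scale scaleN1r. Qed.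

Lemma sem_mul p q : sem (mmul p q) = sem p * sem q.
Proof.
rewrite /sem big_allpairs_dep mulr_suml; apply: eq_bigr => t _; rewrite mulr_sumr.
apply: eq_bigr => u _ /=; rewrite -scalerAl -scalerAr scalerA -mpolyXD.
by congr (_ *: 'X_[_]); apply/mnmP => i; rewrite mnmDE !mnmE ffunE.
Qed.

Lemma sem_one : sem (mone K n) = 1.
Proof.
rewrite /sem big_seq1 scale1r -mpolyX0; congr 'X_[_].
by apply/mnmP => i; rewrite mnmE ffunE mnm0E.
Qed.

Lemma sem_pow p k : sem (mpow p k) = sem p ^+ k.
Proof.
elim: k => [|k IH]; first exact: sem_one.
by rewrite /mpow iterS sem_mul -/(mpow p k) IH exprS.
Qed.

Lemma sem_X i : sem (Defs.mX K i) = 'X_i.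
Proof.
rewrite /sem big_seq1 scale1r; congr 'X_[_].
by apply/mnmP => j; rewrite mnmE ffunE mnm1E eq_sym.
Qed.

Lemma sem_sum (I : Type) (r : seq I) (P : pred I) (F : I -> Defs.mpoly K n) :
  sem (\big[@madd K n/@mzero K n]_(i <- r | P i) F i) = \sum_(i <- r | P i) sem (F i).
Proof.
by elim/big_rec2: _ => [|i x y _ <-]; [rewrite /sem big_nil | rewrite sem_add].
Qed.

Definition quote (u : R) : Defs.mpoly K n := [seq (u@_m, mono_of m) | m <- msupp u].

Lemma quoteK u : sem (quote u) = u.
Proof.
rewrite /sem big_map [RHS]mpolyE; apply: eq_bigr => m _ /=.
by rewrite mono_ofK.
Qed.

Lemma mdeg_mnm_of e : mpoly.mdeg (mnm_of e) = Defs.mdeg e.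
Proof. by rewrite mdegE; apply: eq_bigr => i _; rewrite mnmE. Qed.

Lemma homog_form k p : Defs.homog k p <-> form k (sem p).
Proof.
split=> [hp|fp e pe].
  rewrite [sem p]mpolyE big_seq; apply: form_sum => m; rewrite mcoeff_msupp.
  rewrite -[m]mono_ofK coeff_sem => /hp <-; rewrite -mdeg_mnm_of -mul_mpolyC.
  exact/form_scale/form_Xm.
apply/eqP; move: pe; rewrite -coeff_sem -mdeg_mnm_of -(pihomog_id_form fp) pihomogE.
apply: contraR => ne; rewrite raddf_sum big1 // => m /eqP mk /=.
rewrite mcoeffZ mcoeffX; case: eqP => [em|_]; last by rewrite mulr0.
by rewrite -em mk eqxx in ne.
Qed.

Lemma in_idealP (g : 'I_n -> Defs.mpoly K n) p :
  in_ideal g p <-> ideal_on setT (fun i => sem (g i)) (sem p).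
Proof.
split=> [[h /semP->]|[h Eh]].
  exists (fun i => sem (h i)); rewrite sem_sum; apply: eq_big => i; rewrite ?inE //.
  by rewrite sem_mul.
exists (fun i => quote (h i)); apply/semP; rewrite Eh sem_sum.
by apply: eq_big => i; rewrite ?inE // sem_mul quoteK.
Qed.

End Bridge.

Section LineRestriction.

Variables (K : fieldType) (n : nat) (d : 'I_n -> nat) (a : 'I_n -> 'I_n -> K).
Hypothesis d_gt0 : forall i, (0 < d i)%N.

(** A nonzero v violating [principal] spans a line on which all generators vanish. Restriction to it
    would make K[X] contain X^B in the span of polynomials of size at most B. *)
Lemma finite_dim_principal (g : 'I_n -> Defs.mpoly K n) :
    (forall i, sem (g i) = power_form d a i) -> finite_dim g -> principal a.
Proof.
move=> gE [s sP] v vP i0; apply/eqP/negPn/negP => vi0.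
pose ev : {rmorphism {mpoly K[n]} -> {poly K}} := mmap (@polyC K) (fun i => v i *: 'X).
have evX i : ev 'X_i = v i *: 'X by rewrite /ev /= mmapX mmap1U.
have evC k : ev k%:MP = k%:P by rewrite /ev /= mmapC.
have evg i : ev (sem (g i)) = 0.
  rewrite gE /power_form rmorphM rmorphXn evX.
  case: (vP i) => [->|lv]; first by rewrite scale0r expr0n gtn_eqF ?mul0r.
  rewrite [X in _ * X](_ : _ = 0) ?mulr0 // /linform rmorph_sum.
  under eq_bigr => j _ do rewrite rmorphM evC evX mul_polyC scalerA.
  by rewrite -scaler_suml lv scale0r.
pose B := (\max_(j < size s) size (ev (sem (nth (mzero K n) s j))))%N.
have [c /in_idealP[h]] := sP (mpow (Defs.mX K i0) B).
move/(congr1 ev); rewrite [RHS]rmorph_sum [RHS]big1 => [|j _]; last by rewrite rmorphM evg mulr0.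
rewrite sem_sub sem_pow sem_X rmorphB rmorphXn evX => /eqP; rewrite subr_eq0 => /eqP.
move/(congr1 (fun p : {poly K} => size p)); rewrite exprZn size_scale ?expf_neq0 // size_polyXn.
rewrite sem_sum rmorph_sum => sB.
have : (size (\sum_(j < size s) ev (sem (mscale (c j) (nth (mzero K n) s j))))%R <= B)%N.
  apply: leq_trans (size_sum _ _ _) _; apply/bigmax_leqP => j _.
  rewrite sem_scale -mul_mpolyC rmorphM evC mul_polyC; apply: leq_trans (size_scale_leq _ _) _.
  exact: (leq_bigmax (F := fun j : 'I_(size s) => size (ev (sem (nth (mzero K n) s j))))).
by rewrite -sB ltnn.
Qed.

End LineRestriction.

Section Lefschetz.

Variables (K : fieldType) (n : nat) (d : 'I_n -> nat) (a : 'I_n -> 'I_n -> K).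
Hypothesis charK : [pchar K] =i pred0.
Hypothesis pa : principal a.
Hypothesis d_gt0 : forall i, (0 < d i)%N.
Hypothesis a_band : forall i j : 'I_n, (i.+1 < j)%N -> a i j = 0.
Local Notation R := {mpoly K[n]}.
Local Notation phi := (@mpolyC n K : {rmorphism K -> R}).
Local Notation form := (form phi (vars 0 n (@mvar K n))).

Let ext (T : Type) (x : T) (f : 'I_n -> T) (i : nat) := oapp f x (insub i).

Let extE (T : Type) (x : T) f (i : 'I_n) : ext x f i = f i.
Proof. by rewrite /ext valK. Qed.

Let an i j : K := ext 0 (fun i' => ext 0 (a i') j) i.

Let bandE (R' : comNzRingType) (psi : {rmorphism K -> R'}) v (i : 'I_n) :
  band psi an 0 n v i = \sum_j psi (a i j) * v j.
Proof.
rewrite /band big_mkord big_mkcond; apply: eq_bigr => j _; rewrite /an !extE.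
by case: leqP => // /a_band->; rewrite rmorph0 mul0r.
Qed.

Lemma lefschetz_power_form : exists2 l : R, form 1 l &
  lefschetz phi (vars 0 n (@mvar K n)) (fun _ => ideal_on setT (power_form d a)) (\sum_i d i) l.
Proof.
have ideal_graded : graded_ideal phi (vars 0 n (@mvar K n))
    (fun _ => ideal_on setT (power_form d a)).
  split=> [m|m p q|m c p|m x p _]; last exact: ideal_onM.
  - exact: ideal_on0.
  - exact: ideal_onD.
  - exact: ideal_onM.
have [||||j jn|gamma lef] :=
  @lefschetz_band K charK n 0 n (ext 0%N d) an R phi (@mvar K n) _ _ _ _ _ ideal_graded.
- by [].
- by rewrite subn0.
- move=> v vP j /= jn; apply: (@pa (fun i => v i) _ (Ordinal jn)) => i.
  by have := vP i (ltn_ord i); rewrite (bandE idfun).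
- by move=> j /andP[_ jn]; rewrite -[j]/(val (Ordinal jn)) extE.
- rewrite -[j]/(val (Ordinal (jn : (j < n)%N))) extE bandE mvarE.
  under eq_bigr => i _ do rewrite mvarE.
  exact/ideal_on_gen/in_setT.
exists (lincomb phi 0 n gamma (@mvar K n)); first exact: form_lincomb.
have E : (\sum_(0 <= j < n) ext 0 d j = \sum_i d i)%N.
  by rewrite big_mkord; apply: eq_bigr => i _; rewrite extE.
by rewrite E in lef.
Qed.

Lemma power_form_proper : ~ ideal_on setT (power_form d a) 1.
Proof.
case=> h /(congr1 (mcoeff 0)); rewrite mcoeff1 eqxx rmorph_sum big1 => [|i _].
  by move/eqP; rewrite oner_eq0.
rewrite /power_form -[d i]prednK // exprS !rmorphM /=.
by rewrite mcoeffX mnm1_eq0 !mul0r mulr0.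
Qed.

Lemma SLP_power_form (g : 'I_n -> Defs.mpoly K n) :
  (forall i, sem (g i) = power_form d a i) -> SLP g.
Proof.
move=> gE; have [l fl lef] := lefschetz_power_form.
have [rf vf sf] := power_form_regular d pa.
set c := (\sum_i d i)%N in lef vf sf.
have inP p : in_ideal g p <-> ideal_on setT (power_form d a) (sem p).
  by rewrite in_idealP; split; apply: eq_ideal_on => i _; rewrite gE.
pose I := ideal_on setT (power_form d a).
have sup p m : (c < m)%N -> form m p -> I p by exact: vf.
exists c; split; last split.
(* If all forms of degree c were in I, the pairing property at 1 would put 1 in I. *)
- apply: Classical_Prop.NNPP => noq; apply: power_form_proper.
  apply: (sf 0%N) => //; first exact: form_one.
  rewrite subn0 => q fq; rewrite mul1r; apply: Classical_Prop.NNPP => Iq; apply: noq.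
  by exists (quote q); rewrite homog_form inP quoteK.
- by move=> k lt_ck p /homog_form fp; apply/inP/(sup _ k).
exists (quote l); split; first by rewrite homog_form quoteK.
(* For c <= 2i + e the exponent 2(i+e) - c is at least e, so surjectivity of that power factors
   through l^e. *)
move=> e i e1 ic; have [le|gt] := leqP c (2 * i + e); [right=> q | left=> p].
  move=> /homog_form fq; have [|u [fu Iu]] := lef (i + e)%N _ (sem q) fq; first by lia.
  exists (quote (l ^+ (2 * (i + e) - c - e) * u)); split.
    rewrite homog_form quoteK; move: fu; rewrite /formz; case: leqP => [le_iec fu|_ ->].
      have E : (i = (2 * (i + e) - c - e) + (c - (i + e)))%N by lia.
      by rewrite [X in form X _]E; apply: form_mul fu; apply: form_pow.
    by rewrite mulr0; apply: form_zero.
  rewrite inP sem_sub sem_mul sem_pow !quoteK mulrA -exprD subnKC //; lia.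
(* Here e < c - 2i, so l^e p in I gives l^(c-2i) p in I, and p annihilates all forms of degree c -
   i. *)
move=> /homog_form fp; rewrite !inP sem_mul sem_pow quoteK => Ip.
apply: (sf i) fp _ => [|q fq]; first by lia.
have [|u [fu Iu]] := lef (c - i)%N _ q fq; first by lia.
rewrite -[q](subrK (l ^+ (2 * (c - i) - c) * u)) mulrDr; apply: ideal_onD; first exact: ideal_onM.
have -> : (2 * (c - i) - c = (2 * (c - i) - c - e) + e)%N by lia.
have -> : sem p * (l ^+ (2 * (c - i) - c - e + e) * u) =
    l ^+ (2 * (c - i) - c - e) * u * (l ^+ e * sem p) by rewrite exprD; ring.
exact: ideal_onM.
Qed.

End Lefschetz.

Theorem theorem3p1 (K : fieldType) (n : nat) (d : 'I_n -> nat)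
    (a : 'I_n -> 'I_n -> K) :
  [pchar K] =i pred0 ->
  (1 <= n)%N ->
  (forall i, (0 < d i)%N) ->
  ((2 <= n)%N -> finite_dim (gens d a)) ->
  SLP (gens d a).
Proof.
move=> charK n_gt0 d_gt0 fin.
(* For n = 1 the coefficient 1 writes x_1^(d_1+1) as x_1^(d_1) times the linear form x_1. *)
pose b (i j : 'I_n) := if (j <= i.+1)%N then (if n == 1%N then 1 else a i j) else 0.
have gE i : sem (gens d a i) = power_form d b i.
  rewrite /gens /power_form /linform; have [n1|n1] := boolP (n == 1%N).
    have all_i j : j = i by apply: val_inj => /=; have := ltn_ord i; have := ltn_ord j; lia.
    rewrite sem_pow sem_X exprSr; congr (_ * _).
    rewrite (bigD1 i) //= big1 ?addr0 => [|j]; last by rewrite [j]all_i eqxx.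
    by rewrite /b leqnSn n1 mpolyC1 mul1r.
  rewrite sem_mul sem_pow sem_X; congr (_ * _).
  rewrite /lform sem_sum big_mkcond; apply: eq_bigr => j _.
  rewrite /b (negPf n1); case: ifP => _; last by rewrite mpolyC0 mul0r.
  by rewrite sem_scale sem_X mul_mpolyC.
have pb : principal b.
  have [n1|n1] := boolP (n == 1%N); last first.
    by apply: (finite_dim_principal d_gt0 gE); apply: fin; lia.
  move=> v vP i; have all_j j : j = i by apply: val_inj => /=; have := ltn_ord i; have := ltn_ord j; lia.
  case: (vP i) => //; rewrite (bigD1 i) //= big1 ?addr0 => [|j]; last by rewrite [j]all_j eqxx.
  by rewrite /b leqnSn n1 mul1r.
apply: (SLP_power_form charK pb d_gt0 _ gE) => i j ij.
by rewrite /b leqNgt ij.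
Qed.
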